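(* Let $g\in\mathbb{F}_q[T]$ be monic with $\deg(g)\ge1$, let $\ell\in\mathbb{F}_q[T]$ be monic, and let $c\in\mathbb{F}_q[T]$ be such that $(\ell c,g)=1$. Let $\chi$ be a primitive Dirichlet character modulo $\ell$. Then, for all $u\in\mathbb{C}$ (as an identity of meromorphic functions of $u$), $$\mathcal{R}_2\Big(u;\chi,\frac cg\Big)=\chi(g)G(\chi)(qu^2)^{\deg(g)-1}u^{\deg(\ell)}\sum_{\lambda\in\mathbb{F}_q^\times}\mathcal{B}_\lambda(u;\overline\chi)\,\mathcal{R}_2\Big(\frac{1}{qu};\overline\chi,\frac{\lambda\overline c}{g}\Big),$$ where $\overline c$ is an inverse of $c$ modulo $g$ and $$\mathcal{B}_\lambda(u;\chi):=\sum_{\eta_1,\eta_2\in\{0,1\}}(-1)^{\eta_1+\eta_2}\frac{\mathrm{Kl}_\chi\big(\eta_1-1,(1-\eta_2)\lambda\big)}{q(1-qu)^{\eta_1+\eta_2}}=\frac{\mathrm{Kl}_\chi(-1,\lambda)}{q}-\frac{\tau(\chi,-1)+\tau(\overline\chi,\lambda)}{q(1-qu)}+\frac{q-1}{q(1-qu)^2}\mathbf{1}(\chi\text{ is even}).$$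
   Context: $q=p^\eta$ is a prime power; $e_q(y)=\exp(2\pi i\,\mathrm{Tr}_{\mathbb{F}_q/\mathbb{F}_p}(y)/p)$ for $y\in\mathbb{F}_q$; for $\alpha=\sum_{j\le N}\alpha_jT^j\in\mathbb{F}_q((1/T))$, $e(\alpha)=e_q(\alpha_{-1})$. $\mathcal{M}$ is the set of monic polynomials in $\mathbb{F}_q[T]$. $r_\chi(f)=\sum_{g\mid f}\chi(g)$ over monic divisors $g$. $G(\chi)=\sum_{a\ (\mathrm{mod}\ \ell)}\chi(a)e(a/\ell)$. For $\alpha,\beta\in\mathbb{F}_q$, $\mathrm{Kl}_\chi(\alpha,\beta)=\sum_{\gamma\in\mathbb{F}_q^\times}\chi(\gamma)e_q(\alpha\gamma+\beta\gamma^{-1})$ and $\tau(\chi,\alpha)=\sum_{\gamma\in\mathbb{F}_q^\times}\chi(\gamma)e_q(\alpha\gamma)$ (using the restriction of $\chi$ to $\mathbb{F}_q^\times$). A Dirichlet character is even if it is trivial on $\mathbb{F}_q^\times$. $\mathcal{R}_2(u;\chi,c/g)=\sum_{f\in\mathcal{M}}r_\chi(f)e(cf/g)u^{\deg f}$ for $|u|<1/q$, extended meromorphically to $\mathbb{C}$. The modulus $\ell$ need not be irreducible, and $\ell=1$ (with $\chi=1$) is allowed.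
   Formalization: Here c̄ is an inverse of ℓc modulo g, not of c modulo g as printed; with an inverse of c alone the identity fails, e.g. for q=3, g=T, ℓ=T−1, c=1 and χ the quadratic character modulo ℓ. *)

(* Defs.v *)
From HB Require Import structures.
From mathcomp Require Import all_boot all_order all_algebra all_field.
From mathcomp Require Import finmap complex zify.
From mathcomp Require Import all_classical all_reals all_analysis.
From mathcomp Require Import showcase.summability.

Set Implicit Arguments.
Unset Strict Implicit.
Unset Printing Implicit Defensive.

Import Order.TTheory GRing.Theory Num.Theory numFieldNormedType.Exports.
Local Open Scope classical_set_scope.
Local Open Scope ring_scope.

Section Meromorphic.
Context {R : realType}.
Local Notation C := R[i]^o.
Implicit Types (f h : C -> C) (z w : C).

Definition analytic_at f z :=
  exists a : nat -> C,
    \forall w \near z, series (fun k => a k * (w - z) ^+ k) @ \oo --> f w.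

(* The value at a pole is normalized to 0, so that a meromorphic function has
   no removable singularities and is determined by its germ at any point. *)
Definition meromorphic_at f z :=
  analytic_at f z \/
  f z = 0 /\ exists (m : nat) (h : C -> C),
    [/\ (0 < m)%N, analytic_at h z, h z != 0
      & \forall w \near z^', f w = h w / (w - z) ^+ m].

Definition meromorphic f := forall z, meromorphic_at f z.

(* Two functions that are each defined up to isolated singularities agree as
   meromorphic functions on the whole plane. *)
Definition mero_eq f h := forall z, \forall w \near z^', f w = h w.

End Meromorphic.

Section LaurentSeries.
Context {F : fieldType}.
Implicit Types (a b : {poly F}) (n : int).

(* The coefficient of T^n in the expansion of a / b in F((1/T)): for n < 0 it is
   the constant term of the polynomial part of T^(-n) a / b. *)
Definition laurent a b n : F :=
  match n with
  | Posz k => (a %/ b)`_k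
  | Negz k => (('X^(k.+1) * a) %/ b)`_0
  end.

Lemma coef_divXn a b (k m : nat) : (b != 0) ->
  ((('X^k * a) %/ b)`_(k + m) = (a %/ b)`_m).
Proof.
move=> b0.
have -> : ('X^k * a) %/ b = 'X^k * (a %/ b) + ('X^k * (a %% b)) %/ b.
  by rewrite {1}(divp_eq a b) mulrDr mulrA divpD mulpK.
rewrite coefD coefXnM ltnNge leq_addr /= addKn [X in _ + X]nth_default ?addr0//.
have [->|ab0] := eqVneq (a %% b) 0; first by rewrite mulr0 div0p size_poly0.
have sb : (size (a %% b)%R < size b)%N by rewrite ltn_modp.
have sm : (size ('X^k * (a %% b))%R <= k + size (a %% b)%R)%N.
  by rewrite mulrC size_mulXn.
rewrite size_divp //.
move: sm sb; case: (size b) => [//|s] h1; rewrite ltnS /= => h2.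
rewrite leq_subLR; apply: leq_trans h1 _; rewrite addnC.
exact: leq_add (leq_addr m k).
Qed.

Lemma laurent_shift a b (k m : nat) : (b != 0) ->
  laurent a b (m%:Z - k%:Z) = (('X^k * a) %/ b)`_m.
Proof.
move=> b0; have [km|mk] := leqP k m.
  rewrite -{2}(subnKC km) coef_divXn //.
  by have -> : m%:Z - k%:Z = Posz (m - k)%N by lia.
have -> : m%:Z - k%:Z = Negz (k - m).-1 by lia.
rewrite /laurent prednK ?subn_gt0 // -(coef_divXn ('X^(k - m) * a) m 0 b0).
by rewrite addn0 mulrA -exprD subnKC // ltnW.
Qed.

(* b * laurent a b = a in F((1/T)), as a convolution of coefficient functions. *)
Lemma laurentP a b n : (b != 0) ->
  \sum_(i < size b) b`_i * laurent a b (n - i%:Z)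
  = if n is Posz k then a`_k else 0.
Proof.
move=> b0; pose k := (size b + absz n)%N.
have [m Dm] : exists m : nat, n = m%:Z - k%:Z.
  by exists (absz (n + k%:Z)); rewrite /k; lia.
have sm : (size b <= m)%N by move: Dm; rewrite /k; lia.
transitivity (('X^k * a)`_m).
  rewrite [in RHS](divp_eq ('X^k * a) b) coefD [X in _ + X]nth_default; last first.
    by rewrite (leq_trans (ltnW _) sm) // ltn_modp.
  rewrite addr0 mulrC coefM.
  rewrite -(big_mkord predT (fun i => b`_i * laurent a b (n - i%:Z))).
  rewrite -(big_mkord predT (fun i => b`_i * (('X^k * a) %/ b)`_(m - i))).
  rewrite [RHS](@big_cat_nat _ _ _ (size b)) //=; last exact: leq_trans sm (leqnSn m).
  rewrite [X in _ = _ + X]big_nat_cond [X in _ = _ + X]big1 ?addr0; last first.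
    by move=> i /andP[/andP[si _] _]; rewrite nth_default ?mul0r.
  apply: eq_big_nat => i /andP[_ ib]; congr (_ * _).
  have im : (i <= m)%N by apply: leq_trans (ltnW ib) sm.
  by rewrite -laurent_shift //; congr laurent; lia.
rewrite coefXnM; clearbody k; case: n Dm => j Dm.
  have -> : (m < k)%N = false by lia.
  by congr (_`_ _); lia.
by have -> : (m < k)%N by lia.
Qed.

Lemma laurent_bounded a b (k : nat) : (size a <= k)%N -> laurent a b k%:Z = 0.
Proof. by move=> h; rewrite /laurent nth_default // (leq_trans (leq_divp _ _)). Qed.

End LaurentSeries.

Section Arithmetic.
Context {R : realType} {F : finFieldType} {p : nat}.
Variable pcharFp : p \in [pchar F].
Local Notation C := R[i]^o.
Local Notation q := (#|F|%:R : C).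
Implicit Types (f g l a c : {poly F}) (chi : {poly F} -> C) (u : C).

Local Notation L := (pPrimeCharType pcharFp).

(* The representative in [0, p) of the trace from F to its prime field. *)
Definition trace_nat (y : F) : nat :=
  if [pick k : 'I_p | (k%:R : L) == galTrace 1 {:L} (y : L)] is Some k
  then val k else 0%N.

Lemma trace_natP (y : F) :
  (trace_nat y)%:R = galTrace 1 {:L} (y : L) :> L.
Proof.
have gal : galois 1 {:L} by exact: (@finField_galois _ L 1%AS {:L}%AS (sub1v _)).
have /vlineP[k Dk] := mem_galTrace gal (memvf (y : L)).
rewrite /trace_nat; case: pickP => [j /eqP //|no].
have pp := pcharf_prime pcharFp.
have kp : (k < p)%N by rewrite -[X in (_ < X)%N](Fp_cast pp).
by have := no (Ordinal kp); rewrite /= Dk -[_ *: _]/(_%:R * 1) mulr1 eqxx.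
Qed.

Definition e_q (y : F) : C :=
  let t : R := 2 * pi * (trace_nat y)%:R / p%:R in (cos t +i* sin t)%C.

Definition e_infty (alpha : int -> F) : C := e_q (alpha (- 1)).

Record dirichlet_character l chi : Prop := {
  dirichlet1 : chi 1 = 1;
  dirichletM : forall f g, chi (f * g) = chi f * chi g;
  dirichlet_mod : forall f g, l %| f - g -> chi f = chi g;
  dirichlet_supp : forall f, (chi f != 0) = coprimep f l }.

Definition primitive_character l chi :=
  dirichlet_character l chi /\
  forall d, d \is monic -> d %| l ->
    (forall f, coprimep f l -> d %| f - 1 -> chi f = 1) -> d = l.

Definition even_character chi : bool :=
  [forall x : F, (x != 0) ==> (chi x%:P == 1)].

Definition conj_char chi : {poly F} -> C := fun f => (chi f)^*.

Definition r_chi chi f : C :=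
  \sum_(d : {poly_(size f) F} | ((d : {poly F}) \is monic) && ((d : {poly F}) %| f))
    chi d.

Definition gauss l chi : C :=
  \sum_(a : {poly_((size l).-1) F}) chi a * e_infty (laurent a l).

Definition Kl chi (x y : F) : C :=
  \sum_(z : F | z != 0) chi z%:P * e_q (x * z + y * z^-1).

Definition tau chi (x : F) : C :=
  \sum_(z : F | z != 0) chi z%:P * e_q (x * z).

(* i and j are the eta_1 and eta_2 in {0, 1} of the usual notation. *)
Definition B2 chi (x : F) u : C :=
  \sum_(i < 2) \sum_(j < 2)
    (-1) ^+ (i + j) * Kl chi (i%:R - 1) ((1 - j%:R) * x)
      / (q * (1 - q * u) ^+ (i + j)).

Definition R2_term chi c g u (f : {f : {poly F} | f \is monic}) : C :=
  r_chi chi (val f) * e_infty (laurent (c * val f) g) * u ^+ (size (val f)).-1.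

(* h is the meromorphic continuation of the sum over all monic f; the sum is
   unordered: it converges along the finite sets of monic polynomials. *)
Definition is_R2 chi c g (h : C -> C) :=
  meromorphic h /\
  forall u, `|u| < q^-1 -> partial_sum (R2_term chi c g u) @ totally --> h u.

Definition R2 chi c g : C -> C := xget (fun=> 0) (is_R2 chi c g).

End Arithmetic.

(* Main.v *)
(* Opening the definition of r_chi, the coefficients of R_2 are the sums
   S(i,j) = sum chi(d) e(c d m / g) over monic d, m of degrees i and j.  Poisson
   summation in d (modulo g ell, with the Gauss sum of chi) and in m (modulo g)
   turns S(i,j) into a sum of chibar(t) e(cbar t r / g) over deg t < n + k - i,
   deg r < n - j, where n = deg g and k = deg ell; the top coefficients of t and r
   are twisted by e_q.  Sorting t = x d', r = y m' by leading coefficients makes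
   the dual sums S(a,b) for (chibar, xy cbar) appear, and summing over the leading
   coefficients produces the Kloosterman sums.  The powers of 1 / (1 - q u) in B
   come from the geometric series of the degrees a < i, b < j.
   All but finitely many (i,j) contribute an explicit geometric part, so R_2 is a
   rational function with denominator (1 - q u)^2; the identity is one of rational
   functions.  It transfers to R2 because a meromorphic function is determined
   by its germ at 0. *)
Require Import Defs.
From HB Require Import structures.
From mathcomp Require Import all_boot all_order all_algebra all_field.
From mathcomp Require Import finmap complex ring lra zify.
From mathcomp Require Import all_classical all_reals all_analysis.
From mathcomp Require Import showcase.summability.

Set Implicit Arguments.
Unset Strict Implicit.
Unset Printing Implicit Defensive.

Import Order.TTheory GRing.Theory Num.Theory numFieldNormedType.Exports.
Local Open Scope classical_set_scope.
Local Open Scope ring_scope.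

(** * Sums over polynomials of bounded degree *)

Section PolySums.
Context {F : finFieldType} {V : nmodType}.
Implicit Types (f : {poly F} -> V) (d m t : {poly F}).

(** The inverse of ell c, rather than of c, enters through Poisson summation in d: it is done modulo
    g ell, where e(c d m / g) is e(ell c d m / (g ell)), so the congruence that comes out is t = -
    ell c m modulo g. The obstacle is truncation. Only finitely many degrees are dualized, so the
    dual weights are cut off at degrees n + k and n, whereas the dual R_2 wants full geometric
    series in w = 1 / (q u). The missing tails are evaluated in closed form: for k > 0 they are
    multiples of L(w, chibar) times a Gauss sum over the constants. They have to match the polar
    parts of R_2 at u and at w, and what ties L(u, chi) to L(w, chibar) is the functional equation
    of the Dirichlet L-function. For ell = 1 the value chibar(0) is 1 instead of 0, so the terms
    with t = 0 survive and this case is computed separately. *)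

Lemma npoly_ex n (a : {poly F}) : (size a <= n)%N -> exists b : {poly_n F}, a = b.
Proof. by move=> sa; exists (npolyp n a); rewrite npolypK. Qed.

Lemma npoly_sum0 f : \sum_(a : {poly_0 F}) f a = f 0.
Proof.
have E (a : {poly_0 F}) : a = 0.
  by apply: val_inj; apply/eqP; rewrite -size_poly_leq0 size_npoly.
rewrite (bigD1 (0 : {poly_0 F})) //= big1 ?addr0 // => a.
by rewrite (E a) eqxx.
Qed.

Lemma npoly_sum_const n (v : V) : \sum_(a : {poly_n F}) v = v *+ #|F| ^ n.
Proof. by rewrite sumr_const card_npoly. Qed.

(** Euclidean division by d matches t with the pair of its quotient b and its remainder a. *)
Lemma npoly_sum_edivp d n j f : d \is monic -> size d = n.+1 ->
  \sum_(t : {poly_(n + j) F}) f t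
  = \sum_(b : {poly_j F}) \sum_(a : {poly_n F}) f (d * b + a).
Proof.
move=> dm sd; have d0 : d != 0 by rewrite monic_neq0.
have sab (a : {poly_n F}) (b : {poly_j F}) : (size (d * b + a)%R <= n + j)%N.
  rewrite (leq_trans (size_polyD _ _)) // geq_max (leq_trans (size_npoly a)) ?leq_addr //.
  rewrite andbT (leq_trans (size_polyMleq _ _)) // sd /= leq_add2l; exact: size_npoly.
rewrite pair_big /=.
rewrite (reindex (fun ab : {poly_j F} * {poly_n F} => npolyp (n + j) (d * ab.1 + ab.2))) /=.
  by apply: eq_bigr => -[b a] _; rewrite npolypK.
exists (fun t : {poly_(n + j) F} => (npolyp j (t %/ d), npolyp n (t %% d))).
  move=> [b a] _; rewrite npolypK //= mulrC.
  have sa : (size a < size d)%N by rewrite sd ltnS.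
  have [-> ->] : (polyn b * d + a) %/ d = b /\ (polyn b * d + a) %% d = a.
    by rewrite divp_addl_mul_small // modp_addl_mul_small.
  by congr pair; apply: val_inj; rewrite /= npolypK.
move=> t _; apply: val_inj; rewrite /= npolypK.
  rewrite !npolypK 1?[d * _]mulrC -?divp_eq //.
    by rewrite -ltnS -sd ltn_modp.
  by rewrite size_divp // sd /= leq_subLR size_npoly.
exact: sab.
Qed.

Lemma npoly_sum1 f : \sum_(a : {poly_1 F}) f a = \sum_(x : F) f x%:P.
Proof.
rewrite (reindex (fun x : F => npolyp 1 x%:P)) /=.
  by apply: eq_bigr => x _; rewrite npolypK // size_polyC leq_b1.
exists (fun a : {poly_1 F} => a`_0) => [x _|a _].
  by rewrite npolypK ?coefC // size_polyC leq_b1.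
apply: val_inj; rewrite /= npolypK ?size_polyC ?leq_b1 //.
by rewrite -size1_polyC // size_npoly.
Qed.

Lemma npoly_sumS n f :
  \sum_(t : {poly_n.+1 F}) f t
  = \sum_(x : F) \sum_(a : {poly_n F}) f (x *: 'X^n + a).
Proof.
rewrite -[n.+1]addn1 (@npoly_sum_edivp 'X^n n 1) ?monicXn ?size_polyXn //.
rewrite (npoly_sum1 (fun b => \sum_(a : {poly_n F}) f ('X^n * b + a))).
by apply: eq_bigr => x _; apply: eq_bigr => a _; rewrite mulrC mul_polyC.
Qed.

(** Factoring the leading coefficient x out of the whole polynomial leaves a monic cofactor, so that
    multiplicative characters split off their value at x. *)
Lemma npoly_sum_degree n f :
  \sum_(t : {poly_n F}) f t = f 0 +
  \sum_(i < n) \sum_(x : F | x != 0) \sum_(a : {poly_i F}) f (x *: ('X^i + a)).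
Proof.
elim: n => [|n IH]; first by rewrite npoly_sum0 big_ord0 addr0.
rewrite npoly_sumS (bigD1 0) //= big_ord_recr /= addrA.
congr (_ + _).
  by rewrite -IH; apply: eq_bigr => a _; rewrite scale0r add0r.
apply: eq_bigr => x x0.
rewrite (reindex (fun a : {poly_n F} => x *: a)) /=.
  by apply: eq_bigr => a _; rewrite scalerDr.
exists (fun a : {poly_n F} => x^-1 *: a) => a _.
  by rewrite scalerA mulVf // scale1r.
by rewrite scalerA divff // scale1r.
Qed.

Lemma npoly_sum_widen n N f : (n <= N)%N ->
  \sum_(t : {poly_N F} | (size t <= n)%N) f t = \sum_(t : {poly_n F}) f t.
Proof.
move=> nN.
rewrite (reindex_onto (fun t : {poly_n F} => npolyp N t) (fun t : {poly_N F} => npolyp n t)).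
  have sN (t : {poly_n F}) : (size t <= N)%N by rewrite (leq_trans _ nN) ?size_npoly.
  apply: eq_big => [t|t _]; rewrite npolypK // size_npoly /=.
  by apply/eqP; apply: val_inj; rewrite /= npolypK // size_npoly.
by move=> t st; apply: val_inj; rewrite /= !npolypK // size_npoly.
Qed.

(** The polynomials of size at most n represent the residues modulo m, and h is injective on
    residues, hence permutes them. *)
Lemma npoly_sum_mod m n (h : {poly F} -> {poly F}) f :
  m \is monic -> size m = n.+1 ->
  (forall a b, m %| a - b -> f a = f b) ->
  (forall a b, m %| h a - h b -> m %| a - b) ->
  \sum_(a : {poly_n F}) f (h a) = \sum_(a : {poly_n F}) f a.
Proof.
move=> mm sm fm hinj; have m0 : m != 0 by rewrite monic_neq0.
pose hm (a : {poly_n F}) : {poly_n F} := npolyp n (h a %% m).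
have sr (a : {poly F}) : (size (a %% m)%R <= n)%N by rewrite -ltnS -sm ltn_modp.
have hmE (a : {poly_n F}) : hm a = h a %% m :> {poly F} by rewrite npolypK.
have hm_inj : injective hm.
  move=> a b /(congr1 val); rewrite /= !hmE => E.
  have /hinj ab : m %| h a - h b by apply/modp_eq0P; rewrite modpD modpN E subrr.
  apply: val_inj => /=; apply/eqP; rewrite -subr_eq0.
  have := ab; rewrite /dvdp modp_small // sm ltnS.
  rewrite (leq_trans (size_polyD _ _)) // geq_max size_polyN !size_npoly //.
rewrite [RHS](reindex_inj hm_inj) /=; apply: eq_bigr => a _; apply: fm.
by rewrite hmE; apply/modp_eq0P; rewrite modpD modpN modp_id subrr.
Qed.

Lemma monic_multiple_sum d i N f : d \is monic -> size d = i.+1 -> (i <= N)%N ->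
  \sum_(a : {poly_N F} | d %| 'X^N + a) f ('X^N + a)
  = \sum_(b : {poly_(N - i) F}) f (d * ('X^(N - i) + b)).
Proof.
move=> dm sd iN; have d0 : d != 0 by rewrite monic_neq0.
have sb (b : {poly_(N - i) F}) : (size (d * ('X^(N - i) + b) - 'X^N)%R <= N)%N.
  (* In this form both summands have size at most N, because the leading term of d cancels. *)
  have -> : d * ('X^(N - i) + b) - 'X^N = (d - 'X^i) * 'X^(N - i) + d * b.
    by rewrite mulrBl -exprD subnKC // mulrDr addrAC.
  rewrite (leq_trans (size_polyD _ _)) // geq_max; apply/andP; split.
    rewrite (leq_trans (size_polyMleq _ _)) // size_polyXn addnS /=.
    rewrite -[X in (_ <= X)%N](subnKC iN) leq_add2r.
    apply/leq_sizeP => j; rewrite leq_eqVlt => /orP[/eqP <-|ij].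
      by rewrite coefB coefXn eqxx -[X in d`_X]/(i.+1.-1) -sd -lead_coefE (monicP dm) subrr.
    by rewrite coefB coefXn nth_default ?sd // gtn_eqF // subr0.
  rewrite (leq_trans (size_polyMleq _ _)) // sd /=.
  by rewrite -[X in (_ <= X)%N](subnKC iN) leq_add2l size_npoly.
rewrite (reindex_onto (fun b : {poly_(N - i) F} => npolyp N (d * ('X^(N - i) + b) - 'X^N))
  (fun a => npolyp (N - i) (('X^N + a) %/ d - 'X^(N - i)))) /=.
  apply: eq_big => [b|b _]; rewrite npolypK // addrC subrK //.
  rewrite dvdp_mulr ?dvdpp //= mulKp // addrAC subrr add0r.
  by apply/eqP; apply: val_inj; rewrite /= npolypK // size_npoly.
move=> a /dvdpP[e De]; apply: val_inj; rewrite /= De mulpK //.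
have e0 : e != 0.
  apply: contra_eq_neq De => ->; rewrite mul0r; apply/eqP => /(congr1 (fun p : {poly F} => p`_N)).
  rewrite coefD coefXn eqxx nth_default ?size_npoly // addr0 coef0 => /eqP; rewrite oner_eq0 //.
have sa : (size a < size ('X^N : {poly F}))%N by rewrite size_polyXn ltnS size_npoly.
have em : e \is monic.
  rewrite -(monicMr _ dm) -De; apply/monicP; rewrite lead_coefDl //; exact/monicP/monicXn.
have se : size e = (N - i).+1.
  have := congr1 (fun p : {poly F} => size p) De; rewrite size_polyDl // size_polyXn size_mul // sd.
  rewrite addnS /= => E; by rewrite -subSn // E addnK.
have se2 : (size (e - 'X^(N - i))%R <= N - i)%N.
  apply/leq_sizeP => j; rewrite leq_eqVlt => /orP[/eqP <-|ij].
    by rewrite coefB coefXn eqxx -[X in e`_X]/((N - i).+1.-1) -se -lead_coefE (monicP em) subrr.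
  by rewrite coefB coefXn nth_default ?se // gtn_eqF // subr0.
have e1 : d * ('X^(N - i) + (e - 'X^(N - i))) - 'X^N = a.
  by rewrite [_ + (e - _)]addrC subrK mulrC -De addrC addKr.
by rewrite (npolypK se2) e1 npolypK ?size_npoly.
Qed.

End PolySums.

(** * Fourier analysis modulo a polynomial *)

(** Translation by v preserves the sum and multiplies it by th v. *)
Lemma additive_character_sum (V : finZmodType) (K : idomainType) (th : V -> K) (v : V) :
  (forall x y, th (x + y) = th x * th y) -> th v != 1 -> \sum_x th x = 0.
Proof.
move=> thD thv; have : (th v - 1) * \sum_x th x = 0.
  rewrite mulrBl mul1r mulr_sumr [X in _ - X](reindex_inj (addrI v)) /=.
  by rewrite (eq_bigr (fun x => th (v + x))) ?subrr // => x _; rewrite thD.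
by move/eqP; rewrite mulf_eq0 subr_eq0 (negPf thv) => /eqP.
Qed.

(** All that the arithmetic uses of [e_q]; it lets the rational functional equation be proved over
    any numeric field. *)
Record nontrivial_character (F : finFieldType) (K : numFieldType) (psi : F -> K) : Prop := {
  ncharD : forall x y, psi (x + y) = psi x * psi y;
  nchar0 : psi 0 = 1;
  nchar_neq1 : exists x, psi x != 1 }.

Section FourierPoly.
Context {F : finFieldType} {K : numFieldType}.
Variable psi : F -> K.
Hypothesis psiP : nontrivial_character psi.
Let psiD := ncharD psiP.
Let psi0 := nchar0 psiP.
Let psi_nontriv := nchar_neq1 psiP.
Implicit Types (a b d m t : {poly F}).
Local Notation q := (#|F|%:R : K).

(* e(a / m) for the additive character psi in place of e_q. *)
Definition efrac m a := psi ((('X * a) %/ m)`_0).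

Lemma efracD m a b : efrac m (a + b) = efrac m a * efrac m b.
Proof. by rewrite /efrac mulrDr divpD coefD psiD. Qed.

Lemma efrac0 m : efrac m 0 = 1.
Proof. by rewrite /efrac mulr0 div0p coef0. Qed.

Lemma efrac_dvd m a : m != 0 -> m %| a -> efrac m a = 1.
Proof.
move=> m0 /dvdpP[b ->].
by rewrite /efrac mulrA mulpK // mulrC coefMX /= psi0.
Qed.

Lemma efrac_mod m a b : m != 0 -> m %| a - b -> efrac m a = efrac m b.
Proof.
by move=> m0 ab; rewrite -[a](subrK b) efracD (efrac_dvd m0 ab) mul1r.
Qed.

Lemma efrac_scale m d a : d != 0 -> m != 0 -> efrac (d * m) (d * a) = efrac m a.
Proof. by move=> d0 m0; rewrite /efrac mulrCA divp_pmul2l. Qed.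

Lemma efrac_small m n a : m \is monic -> size m = n.+1 -> (size a <= n)%N ->
  efrac m a = psi a`_n.-1.
Proof.
move=> mm sm sa; rewrite /efrac; congr psi.
case: n sm sa => [|n] sm sa.
  have -> : a = 0 by apply/eqP; rewrite -size_poly_leq0.
  by rewrite mulr0 div0p coef0.
(* [r] is the remainder of X a by the monic m; the quotient is the constant that [efrac] reads. *)
rewrite /=; pose r := 'X * a - a`_n *: m.
have sr : (size r < size m)%N.
  rewrite sm ltnS; apply/leq_sizeP => j nj.
  rewrite coefB coefZ coefXM; case: j nj => // j; rewrite ltnS leq_eqVlt => /orP[/eqP <-|nj] /=.
    by rewrite -[X in m`_X]/(n.+2.-1) -sm -lead_coefE (monicP mm) mulr1 subrr.
  have sj : (size m <= j.+1)%N by rewrite sm; lia.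
  by rewrite (nth_default _ sj) mulr0 subr0 nth_default // (leq_trans sa).
have -> : 'X * a = (a`_n)%:P * m + r by rewrite mul_polyC /r addrC subrK.
by rewrite divp_addl_mul_small // coefC.
Qed.

(** If size t is at most n - i, no product t a reaches degree n - 1, whose coefficient is the one
    that [efrac] reads; otherwise a -> e(t a / m) is a nontrivial character. *)
Lemma efrac_sum m n i t : m \is monic -> size m = n.+1 -> (size t <= n)%N ->
  \sum_(a : {poly_i F}) efrac m (t * a) = (size t <= n - i)%:R * q ^+ i.
Proof.
move=> mm sm st; have m0 : m != 0 by rewrite monic_neq0.
have [sti|sti] := leqP (size t) (n - i).
  rewrite mul1r -natrX -[RHS]/(1 *+ _) -npoly_sum_const; apply: eq_bigr => a _.
  have [->|t0] := eqVneq t 0; first by rewrite mul0r efrac0.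
  have s1 : (0 < size t)%N by rewrite size_poly_gt0.
  have sa : (size a <= i)%N := size_npoly a.
  have sta : (size (t * a)%R < n)%N.
    apply: (leq_ltn_trans (size_polyMleq _ _)).
    have -> : ((size t + size a).-1 < n)%N = (size t + size a <= n)%N by lia.
    by rewrite (leq_trans (leq_add sti sa)) // subnK //; lia.
  have sta1 : (size (t * a)%R <= n.-1)%N by move: sta; case: (n).
  by rewrite (efrac_small mm sm (ltnW sta)) nth_default.
rewrite mul0r.
have [x xP] := psi_nontriv.
have t0 : t != 0 by rewrite -size_poly_gt0; lia.
have s1 : (0 < size t)%N by rewrite size_poly_gt0.
have lt0 : lead_coef t != 0 by rewrite lead_coef_eq0.
(* Chosen so that t v has degree n - 1 and leading coefficient x. *)
pose v := (x / lead_coef t) *: ('X^(n - size t) : {poly F}).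
have sv : (size v <= i)%N.
  by rewrite (leq_trans (size_scale_leq _ _)) // size_polyXn; lia.
apply: (@additive_character_sum {poly_i F} K (fun a : {poly_i F} => efrac m (t * a)) (npolyp i v)).
  by move=> a b /=; rewrite mulrDr efracD.
rewrite npolypK // /v -scalerAr.
have sz : (size ((x / lead_coef t) *: (t * 'X^(n - size t))) <= n)%N.
  rewrite (leq_trans (size_scale_leq _ _)) // (leq_trans (size_polyMleq _ _)) //.
  by rewrite size_polyXn; lia.
rewrite (efrac_small mm sm sz) coefZ coefMXn.
have -> : (n.-1 < n - size t)%N = false by lia.
have -> : (n.-1 - (n - size t))%N = (size t).-1 by lia.
by rewrite -lead_coefE mulfVK.
Qed.

Lemma efrac_orthogonality m n t : m \is monic -> size m = n.+1 ->
  \sum_(a : {poly_n F}) efrac m (t * a) = (m %| t)%R%:R * q ^+ n.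
Proof.
move=> mm sm; have m0 : m != 0 by rewrite monic_neq0.
transitivity (\sum_(a : {poly_n F}) efrac m (t %% m * a)).
  apply: eq_bigr => a _; apply: efrac_mod => //.
  by rewrite -mulrBl {1}(divp_eq t m) addrK mulrAC dvdp_mull.
rewrite (efrac_sum _ mm sm) ?subnn ?size_poly_leq0 //.
by rewrite -ltnS -sm ltn_modp.
Qed.

(* q^-i times the sum of e(t d / m) over monic d of degree i, see efrac_monic_sum;
   n is the degree of m. *)
Definition monic_weight m n i t := (size t <= n - i)%:R * efrac m (t * 'X^i).

Lemma efrac_monic_sum m n i t : m \is monic -> size m = n.+1 -> (size t <= n)%N ->
  \sum_(a : {poly_i F}) efrac m (t * ('X^i + a)) = q ^+ i * monic_weight m n i t.
Proof.
move=> mm sm st; rewrite /monic_weight mulrA [q ^+ i * _]mulrC -(efrac_sum _ mm sm st).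
rewrite mulr_suml; apply: eq_bigr => a _.
by rewrite mulrDr addrC efracD.
Qed.

(** For i at least n, the monic polynomials of degree i cover all residues modulo m equally
    often. *)
Lemma efrac_monic_sum_full m n i t : m \is monic -> size m = n.+1 -> (n <= i)%N ->
  \sum_(a : {poly_i F}) efrac m (t * ('X^i + a)) = (m %| t)%R%:R * q ^+ i.
Proof.
move=> mm sm ni; have m0 : m != 0 by rewrite monic_neq0.
transitivity (\sum_(a : {poly_i F}) efrac m (t %% m * ('X^i + a))).
  apply: eq_bigr => a _; apply: efrac_mod => //.
  by rewrite -mulrBl {1}(divp_eq t m) addrK mulrAC dvdp_mull.
rewrite (efrac_monic_sum _ mm sm) -1?ltnS -1?sm ?ltn_modp // /monic_weight mulrC.
have -> : (n - i)%N = 0%N by apply/eqP; rewrite subn_eq0.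
rewrite size_poly_leq0 /dvdp; case: eqP => [->|_]; last by rewrite !mul0r.
by rewrite mul0r efrac0 !mul1r.
Qed.

(** Multiplication by X^i moves the coefficient of index n - 1 - i into position n - 1. This
    reflection of degrees is the source of the substitution u -> 1 / (q u). *)
Lemma monic_weight_lt m n i t : m \is monic -> size m = n.+1 -> (size t <= n)%N -> (i < n)%N ->
  monic_weight m n i t = (size t <= n - i)%:R * psi t`_(n.-1 - i).
Proof.
move=> mm sm st i_n; rewrite /monic_weight; case: leqP => [sti|]; last by rewrite !mul0r.
have sz : (size (t * 'X^i)%R <= n)%N.
  rewrite (leq_trans (size_polyMleq _ _)) // size_polyXn; lia.
rewrite (efrac_small mm sm sz) coefMXn; have -> // : (n.-1 < i)%N = false by lia.
Qed.

(** Fourier inversion modulo m: when t is summed first, orthogonality leaves only the residue a of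
    d. *)
Lemma efrac_inversion m n d (f : {poly F} -> K) : m \is monic -> size m = n.+1 ->
  (forall a b, m %| a - b -> f a = f b) ->
  q ^+ n * f d
  = \sum_(t : {poly_n F}) (\sum_(a : {poly_n F}) f a * efrac m (polyn t * a)) * efrac m (- (polyn t * d)).
Proof.
move=> mm sm fm; have m0 : m != 0 by rewrite monic_neq0.
transitivity (\sum_(a : {poly_n F}) f a * ((m %| polyn a - d)%R%:R * q ^+ n)).
  have [a0 Da] : exists a0 : {poly_n F}, d %% m = a0.
    by apply: npoly_ex; rewrite -ltnS -sm ltn_modp.
  have mda : m %| polyn a0 - d by apply/dvdpP; exists (- (d %/ m));
    rewrite -Da {2}(divp_eq d m) opprD addrCA subrr addr0 mulNr.
  rewrite (bigD1 a0) //= mda mul1r mulrC (fm _ _ mda) big1 ?addr0 // => a aa0.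
  have -> : m %| polyn a - d = false; last by rewrite mul0r mulr0.
  apply: contraNF aa0 => mad; apply/eqP; apply: val_inj => /=.
  rewrite -[polyn a](@modp_small _ _ m) ?sm ?ltnS ?size_npoly // -Da.
  by apply/eqP; rewrite -subr_eq0 -modpN -modpD -/(dvdp _ _).
under eq_bigr => a _ do rewrite -(efrac_orthogonality _ mm sm) mulr_sumr.
rewrite exchange_big /=; apply: eq_bigr => t _; rewrite mulr_suml.
apply: eq_bigr => a _; rewrite -mulrA -efracD; congr (_ * efrac _ _).
by rewrite -mulrBr mulrC.
Qed.

Lemma psi_sum : \sum_x psi x = 0.
Proof. have [x] := psi_nontriv; exact: additive_character_sum. Qed.

End FourierPoly.

(** * Gauss sums and the dual form of the coefficients *)

(* chib plays the role of the complex conjugate of chi.  Keeping the two on the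
   same footing lets the results on chi be applied to chib. *)
Record primitive_pair (F : finFieldType) (K : numFieldType) (l : {poly F})
    (chi chib : {poly F} -> K) : Prop := {
  pairM : forall a b, chi (a * b) = chi a * chi b;
  pair_mod : forall a b, l %| a - b -> chi a = chi b;
  pair_ncop : forall a, ~~ coprimep a l -> chi a = 0;
  pairbM : forall a b, chib (a * b) = chib a * chib b;
  pairb_mod : forall a b, l %| a - b -> chib a = chib b;
  pairb_ncop : forall a, ~~ coprimep a l -> chib a = 0;
  pair_inv : forall a, coprimep a l -> chi a * chib a = 1;
  pair_prim : forall d, d \is monic -> d %| l ->
    (forall f, coprimep f l -> d %| f - 1 -> chi f = 1) -> d = l }.

Lemma primitive_pair_sym (F : finFieldType) (K : numFieldType) (l : {poly F})
    (chi chib : {poly F} -> K) : primitive_pair l chi chib -> primitive_pair l chib chi.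
Proof.
case=> M md nc Mb mdb ncb inv prim; split=> // [a al|d dm dl h].
  by rewrite mulrC inv.
by apply: prim => // f fl df; rewrite -(inv f fl) h // mulr1.
Qed.

Section TwistedSums.
Context {F : finFieldType} {K : numFieldType}.
Variable psi : F -> K.
Hypothesis psiP : nontrivial_character psi.
Let psiD := ncharD psiP.
Let psi0 := nchar0 psiP.
Let psi_nontriv := nchar_neq1 psiP.
Variables (l : {poly F}) (k : nat).
Hypothesis l_monic : l \is monic.
Hypothesis size_l : size l = k.+1.
Variables chi chib : {poly F} -> K.
Hypothesis chiP : primitive_pair l chi chib.
Let chiM := pairM chiP.
Let chi_mod := pair_mod chiP.
Let chibM := pairbM chiP.
Let chib_mod := pairb_mod chiP.
Let chib_ncop := pairb_ncop chiP.
Let chi_chib := pair_inv chiP.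
Let chi_prim := pair_prim chiP.
Implicit Types (a b d m t h : {poly F}).
Local Notation q := (#|F|%:R : K).
Local Notation E := (efrac psi).

Definition twisted_sum (g : {poly F}) (chi : {poly F} -> K) (c : {poly F}) i j :=
  \sum_(a : {poly_i F}) \sum_(b : {poly_j F})
    chi ('X^i + polyn a) * E g (c * ('X^i + polyn a) * ('X^j + polyn b)).

Definition monic_sum (chi : {poly F} -> K) i := \sum_(a : {poly_i F}) chi ('X^i + polyn a).

Definition gauss_sum := \sum_(a : {poly_k F}) chi a * E l a.

Let l0 : l != 0. Proof. exact: monic_neq0. Qed.
Let q0 : q != 0. Proof. by rewrite pnatr_eq0 -lt0n; apply/card_gt0P; exists 0. Qed.

(** Substitution a -> f a. Nothing is asked of h, because [gauss_ncop] applies this with h not prime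
    to l. *)
Lemma gauss_mul f h : coprimep f l ->
  \sum_(a : {poly_k F}) chi a * E l (polyn a * h)
  = chi f * \sum_(a : {poly_k F}) chi a * E l (polyn a * (f * h)).
Proof.
move=> fl; pose phi a := chi a * E l (a * h).
rewrite -(@npoly_sum_mod _ _ l k (fun a => f * a) phi) //.
- by rewrite mulr_sumr; apply: eq_bigr => a _; rewrite /phi chiM mulrA mulrCA mulrA.
- move=> a b ab; rewrite /phi (chi_mod ab); congr (_ * _); apply: efrac_mod => //.
  by rewrite -mulrBl dvdp_mulr.
- by move=> a b; rewrite -mulrBr Gauss_dvdpr // coprimep_sym.
Qed.

(* Primitivity gives f = 1 mod ell / gcd(h, ell) with chi f != 1, and the
   substitution a -> f a multiplies the sum by chi f. *)
Lemma gauss_ncop h : ~~ coprimep h l ->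
  \sum_(a : {poly_k F}) chi a * E l (polyn a * h) = 0.
Proof.
move=> hl; pose d0 := gcdp h l; pose d := (lead_coef (l %/ d0))^-1 *: (l %/ d0).
have d0l : d0 %| l := dvdp_gcdr h l.
have Dl : l = l %/ d0 * d0 by rewrite divpK.
have q0' : l %/ d0 != 0 by apply: contraNneq l0 => E0; rewrite Dl E0 mul0r.
have lq0 : lead_coef (l %/ d0) != 0 by rewrite lead_coef_eq0.
have dm : d \is monic by apply/monicP; rewrite /d lead_coefZ mulVf.
have dE x : (d %| x) = (l %/ d0 %| x).
  by rewrite /d dvdpZl ?invr_eq0.
have dl : d %| l by rewrite dE {2}Dl dvdp_mulr.
have d00 : d0 != 0 by apply: contraNneq l0 => E0; rewrite Dl E0 mulr0.
(* A nonzero sum forces chi f = 1 for every f prime to l with f = 1 modulo d, so primitivity gives d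
   = l; then gcd(h, l) is constant, against [hl]. *)
apply/eqP; apply: contraTT isT => sum0.
have dl_eq : d = l.
  apply: chi_prim => // f fl df; have := gauss_mul h fl.
  have -> : \sum_(a : {poly_k F}) chi a * E l (polyn a * (f * h)) =
            \sum_(a : {poly_k F}) chi a * E l (polyn a * h).
    apply: eq_bigr => a _; congr (_ * _); apply: efrac_mod => //.
    rewrite -mulrBr dvdp_mull // -[X in _ - X]mul1r -mulrBl {1}Dl.
    by rewrite dvdp_mul // -?dE // dvdp_gcdl.
  rewrite -[LHS]mul1r => /(mulIf sum0); exact.
have : size l = (size (l %/ d0) + size d0).-1.
  by rewrite {1}Dl size_mul.
have : size l = size (l %/ d0) by rewrite -{1}dl_eq /d size_scale ?invr_eq0.
move: hl; rewrite coprimep_def -/d0 => s1 e1 e2.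
have : (0 < size d0)%N by rewrite size_poly_gt0.
move: s1 e1; rewrite e2; case: (size d0) => [|[|m]] // _ + _.
rewrite addnS /= => E0; have := leq_addr m (size (l %/ d0)%R).+1.
by rewrite addSnnS E0 ltnn.
Qed.

Lemma gaussE h :
  \sum_(a : {poly_k F}) chi a * E l (polyn a * h) = chib h * gauss_sum.
Proof.
have [hl|hl] := boolP (coprimep h l); last by rewrite gauss_ncop // chib_ncop ?mul0r.
have -> : gauss_sum = \sum_(a : {poly_k F}) chi a * E l (polyn a * 1).
  by apply: eq_bigr => a _; rewrite mulr1.
by rewrite (gauss_mul 1 hl) mulr1 mulrA [chib h * _]mulrC chi_chib // mul1r.
Qed.

Variables (g : {poly F}) (n : nat).
Hypothesis g_monic : g \is monic.
Hypothesis size_g : size g = n.+1.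
Hypothesis gl : coprimep g l.

Let g0 : g != 0. Proof. exact: monic_neq0. Qed.
Let gl_monic : g * l \is monic. Proof. by rewrite monicMl. Qed.
Let gl0 : g * l != 0. Proof. exact: monic_neq0. Qed.
Let size_gl : size (g * l) = (n + k).+1.
Proof. by rewrite size_mul // size_g size_l addnS. Qed.

(* The shift a -> a + l b keeps chi a and multiplies e(a y / (g l)) by e(b y / g),
   so only g | y survives. *)
Lemma gauss_composite y :
  \sum_(a : {poly_(n + k) F}) chi a * E (g * l) (polyn a * y)
  = (g %| y)%R%:R * (q ^+ n * chib (y %/ g) * gauss_sum).
Proof.
pose phi a := chi a * E (g * l) (a * y).
have [gy|gy] := boolP (g %| y); last first.
  rewrite mul0r.
  have phi_mod a b : g * l %| a - b -> phi a = phi b.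
    move=> ab; rewrite /phi; congr (_ * _).
      by apply: chi_mod; apply: dvdp_trans ab; apply: dvdp_mull.
    by apply: efrac_mod => //; rewrite -mulrBl dvdp_mulr.
  have shift b : \sum_(a : {poly_(n + k) F}) phi a
      = (\sum_(a : {poly_(n + k) F}) phi a) * E g (b * y).
    rewrite -[LHS](@npoly_sum_mod _ _ (g * l) (n + k) (fun a => a + l * b)) //; last first.
      by move=> a c; rewrite opprD addrACA subrr addr0.
    rewrite mulr_suml; apply: eq_bigr => a _; rewrite /phi -mulrA; congr (_ * _).
      by apply: chi_mod; rewrite addrAC subrr add0r dvdp_mulr.
    by rewrite mulrDl efracD // [g * l]mulrC -mulrA efrac_scale // mulrA.
  have : (\sum_(a : {poly_(n + k) F}) phi a) *
         \sum_(b : {poly_n F}) (E g (y * b) - 1) = 0.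
    rewrite mulr_sumr big1 // => b _.
    by rewrite mulrBr mulr1 [y * _]mulrC -shift subrr.
  rewrite sumrB (efrac_orthogonality psiP _ g_monic size_g).
  rewrite (negPf gy) mul0r sub0r npoly_sum_const natrX.
  by move/eqP; rewrite mulf_eq0 oppr_eq0 (negPf (expf_neq0 _ q0)) orbF => /eqP.
(* Write a as l b plus a remainder. As g divides y, both factors depend on the remainder only, and
   each of the q^n values of b contributes the same Gauss sum modulo l. *)
rewrite mul1r; have Dy : y = g * (y %/ g) by rewrite mulrC divpK.
rewrite {1}Dy addnC (npoly_sum_edivp n (fun a => chi a * E (g * l) (a * (g * (y %/ g)))) l_monic size_l).
transitivity (\sum_(b : {poly_n F}) chib (y %/ g) * gauss_sum).
  apply: eq_bigr => b _; rewrite -gaussE; apply: eq_bigr => a _; congr (_ * _).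
    by apply: chi_mod; rewrite addrK dvdp_mulr.
  rewrite mulrCA efrac_scale //; apply: efrac_mod => //.
  by rewrite -mulrBl addrK dvdp_mulr // dvdp_mulr.
by rewrite npoly_sum_const -[LHS]mulr_natl natrX mulrA.
Qed.

(** Fourier inversion in d modulo g l. Over the denominator g l the frequency of e(c d m / g) is c m
    l, and the transform at c m l + t is given by [gauss_composite]. *)
Lemma chi_twist_expansion c d m :
  q ^+ k * (chi d * E g (c * d * m))
  = chi g * gauss_sum * \sum_(t : {poly_(n + k) F})
      chib t * (g %| c * m * l + t)%R%:R * E (g * l) (- (polyn t * d)).
Proof.
have := @efrac_inversion _ _ psi psiP (g * l) (n + k) d
  (fun d => chi d * E g (c * d * m)) gl_monic size_gl.
have h1 a b : g * l %| a - b -> chi a * E g (c * a * m) = chi b * E g (c * b * m).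
  move=> ab; congr (_ * _); first by apply: chi_mod; apply: dvdp_trans ab; apply: dvdp_mull.
  apply: efrac_mod => //; rewrite -mulrBl -mulrBr dvdp_mulr // dvdp_mull //.
  by apply: dvdp_trans ab; apply: dvdp_mulr.
move=> /(_ h1) /= Dinv.
apply: (mulfI (expf_neq0 n q0)).
rewrite [LHS]mulrA -exprD Dinv [RHS]mulrA mulr_sumr.
apply: eq_bigr => t _.
transitivity ((\sum_(a : {poly_(n + k) F}) chi a * E (g * l) (polyn a * (c * m * l + t)))
   * E (g * l) (- (polyn t * d))).
  congr (_ * _); apply: eq_bigr => a _; rewrite -mulrA; congr (_ * _).
  rewrite mulrDr efracD // [polyn a * t]mulrC; congr (_ * _).
  have -> : polyn a * (c * m * l) = l * (c * polyn a * m) by ring.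
  by rewrite [g * l]mulrC efrac_scale.
rewrite gauss_composite mulrA.
have [gy|gy] := boolP (g %| c * m * l + t); last by rewrite !mul0r !mulr0 !mul0r ?mulr0.
rewrite !mul1r mulr1 [in RHS]mulrA; congr (_ * _).
set y := _ + _ in gy *.
(* t and y agree modulo l, and y is g times its quotient. *)
have -> : chib t = chib g * chib (y %/ g).
  rewrite -chibM mulrC divpK //; apply: chib_mod.
  by rewrite /y opprD addrCA subrr addr0 dvdpNr dvdp_mull.
by rewrite -[LHS]mul1r -(chi_chib gl); ring.
Qed.

Lemma monic_weight_ge m N i t : m \is monic -> (N <= i)%N -> monic_weight psi m N i t = (t == 0)%:R.
Proof.
move=> mm Ni; rewrite /monic_weight.
have -> : (N - i)%N = 0%N by apply/eqP; rewrite subn_eq0.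
rewrite size_poly_leq0; case: eqP => [->|_]; last by rewrite mul0r.
by rewrite mul0r efrac0 // mul1r.
Qed.

(** As cb inverts l c modulo g, the condition g | c m l + t reads g | m + cb t. Detecting it by
    orthogonality modulo g introduces the second dual variable r and the phase e(cb t r / g); the
    sums over a and b then give the weights. *)
Lemma twisted_sumE c cb i j : g %| cb * (l * c) - 1 ->
  q ^+ (n + k) * twisted_sum g chi c i j
  = q ^+ (i + j) * (chi g * gauss_sum) *
    \sum_(t : {poly_(n + k) F}) \sum_(r : {poly_n F})
      chib t * E g (cb * polyn t * polyn r)
        * (monic_weight psi (g * l) (n + k) i (- polyn t) * monic_weight psi g n j r).
Proof.
move=> hcb; rewrite exprD /twisted_sum -[LHS]mulrA mulr_sumr.
have cgP x : (g %| x) = (g %| cb * x).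
  have cbg : coprimep g cb.
    rewrite coprimep_sym; apply/Bezout_coprimepP.
    case/dvdpP: hcb => z Dz; exists (l * c, - z) => /=.
    rewrite mulNr -Dz mulrC opprB addrC subrK; exact: eqpxx.
  by rewrite Gauss_dvdpr.
transitivity (q ^+ n * \sum_(a : {poly_i F}) \sum_(b : {poly_j F})
  chi g * gauss_sum * \sum_(t : {poly_(n + k) F}) chib t
     * (g %| c * ('X^j + polyn b) * l + t)%R%:R
     * E (g * l) (- (polyn t * ('X^i + polyn a)))).
  congr (_ * _); apply: eq_bigr => a _; rewrite mulr_sumr; apply: eq_bigr => b _.
  exact: chi_twist_expansion.
pose Y a b t r := chib t * E g (cb * t * r)
   * (E (g * l) (- t * ('X^i + a)) * E g (r * ('X^j + b))).
transitivity (chi g * gauss_sum * \sum_(a : {poly_i F}) \sum_(b : {poly_j F})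
   \sum_(t : {poly_(n + k) F}) \sum_(r : {poly_n F}) Y a b t r).
  rewrite !mulr_sumr; apply: eq_bigr => a _; rewrite !mulr_sumr; apply: eq_bigr => b _.
  rewrite mulrCA; congr (_ * _); rewrite mulr_sumr; apply: eq_bigr => t _.
  have -> : (g %| c * ('X^j + polyn b) * l + t) = (g %| ('X^j + polyn b) + cb * t).
    rewrite cgP mulrDr.
    have -> : cb * (c * ('X^j + polyn b) * l) + cb * t
       = ((cb * (l * c) - 1) * ('X^j + polyn b)) + ('X^j + polyn b + cb * t) by ring.
    by rewrite dvdp_addr // dvdp_mulr.
  transitivity (chib t * E (g * l) (- (polyn t * ('X^i + polyn a))) *
    ((g %| ('X^j + polyn b) + cb * t)%R%:R * q ^+ n)); first by ring.
  rewrite -(efrac_orthogonality psiP _ g_monic size_g) mulr_sumr.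
  apply: eq_bigr => r _; rewrite /Y mulrDl efracD // mulNr [polyn r * _]mulrC; ring.
rewrite [q ^+ (i + j) * _]mulrC -[RHS]mulrA; congr (_ * _).
transitivity (\sum_(t : {poly_(n + k) F}) \sum_(r : {poly_n F})
  \sum_(a : {poly_i F}) \sum_(b : {poly_j F}) Y a b t r).
  under eq_bigr => a _ do rewrite exchange_big.
  rewrite exchange_big; apply: eq_bigr => t _ /=.
  under eq_bigr => a _ do rewrite exchange_big.
  by rewrite exchange_big.
rewrite mulr_sumr; apply: eq_bigr => t _; rewrite mulr_sumr; apply: eq_bigr => r _.
transitivity (chib t * E g (cb * polyn t * polyn r) *
  ((q ^+ i * monic_weight psi (g * l) (n + k) i (- polyn t)) * (q ^+ j * monic_weight psi g n j r))); last first.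
  by rewrite exprD; ring.
rewrite -(efrac_monic_sum psiP i gl_monic size_gl) ?size_polyN ?size_npoly //.
rewrite -(efrac_monic_sum psiP j g_monic size_g) ?size_npoly //.
rewrite mulr_suml mulr_sumr; apply: eq_bigr => a _; rewrite mulr_sumr mulr_sumr.
by apply: eq_bigr => b _; rewrite /Y.
Qed.

Lemma monic_sumE i :
  q ^+ k * monic_sum chi i
  = q ^+ i * gauss_sum * \sum_(t : {poly_k F}) chib t * monic_weight psi l k i (- polyn t).
Proof.
rewrite /monic_sum mulr_sumr.
transitivity (\sum_(a : {poly_i F}) \sum_(t : {poly_k F})
   chib t * gauss_sum * E l (- polyn t * ('X^i + polyn a))).
  apply: eq_bigr => a _.
  rewrite (efrac_inversion psiP ('X^i + polyn a) l_monic size_l chi_mod).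
  apply: eq_bigr => t _; rewrite -gaussE mulNr; congr (_ * _).
  by apply: eq_bigr => b _; rewrite [polyn t * _]mulrC.
rewrite exchange_big mulr_sumr /=; apply: eq_bigr => t _.
rewrite -mulr_sumr (efrac_monic_sum psiP i l_monic size_l) ?size_polyN ?size_npoly //.
by ring.
Qed.

Lemma chib_eq0 : (0 < k)%N -> chib 0 = 0.
Proof.
move=> k0; apply: chib_ncop; rewrite coprime0p -size_poly_eq1 size_l.
by case: (k) k0.
Qed.

Lemma character_mod1 (f : {poly F} -> K) : (forall a b, f (a * b) = f a * f b) ->
  (forall a b, l %| a - b -> f a = f b) -> f 1 != 0 -> k = 0%N -> forall a, f a = 1.
Proof.
move=> fM fmod f1 k0 a.
have l1 : l %= 1 by rewrite -size_poly_eq1 size_l k0.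
rewrite (fmod a 1); last by rewrite (eqp_dvdl _ l1) dvd1p.
by apply: (mulfI f1); rewrite -fM !mulr1.
Qed.

Lemma chi1_neq0 : chi 1 != 0 /\ chib 1 != 0.
Proof.
have : chi 1 * chib 1 != 0 by rewrite chi_chib ?coprime1p ?oner_eq0.
by rewrite mulf_eq0 negb_or => /andP.
Qed.

(** For k > 0 only t = 0 is left on the dual side, and chib vanishes there. *)
Lemma monic_sum_ge i : (k <= i)%N -> monic_sum chi i = (k == 0%N)%:R * q ^+ i.
Proof.
move=> ki; case: (posnP k) => [k0|k0].
  rewrite mul1r /monic_sum.
  under eq_bigr => a _ do rewrite (character_mod1 chiM chi_mod chi1_neq0.1 k0).
  by rewrite npoly_sum_const natrX.
rewrite mul0r; apply: (mulfI (expf_neq0 k q0)).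
rewrite monic_sumE mulr0 big1 ?mulr0 // => t _.
rewrite monic_weight_ge // oppr_eq0; case: eqP => [->|_]; last by rewrite mulr0.
by rewrite chib_eq0 ?mul0r.
Qed.

(* Together with twisted_sum_vanish: outside i < n + k, j < n the coefficients
   are products of a function of i and one of j. *)
Lemma twisted_sum_polar c i j : coprimep c g -> (n <= j)%N ->
  twisted_sum g chi c i j
  = if (n <= i)%N then q ^+ j * chi g * monic_sum chi (i - n) else 0.
Proof.
move=> cg nj.
transitivity (q ^+ j * \sum_(a : {poly_i F} | g %| 'X^i + polyn a) chi ('X^i + polyn a)).
  rewrite mulr_sumr [RHS]big_mkcond /=; apply: eq_bigr => a _.
  rewrite -mulr_sumr (efrac_monic_sum_full psiP _ g_monic size_g nj).
  rewrite Gauss_dvdpr // 1?coprimep_sym //.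
  by case: (g %| _); rewrite ?mul0r ?mulr0 // mul1r mulrC.
case: leqP => [ni|i_n].
  rewrite (monic_multiple_sum _ g_monic size_g ni) -mulrA; congr (_ * _).
  by rewrite mulr_sumr; apply: eq_bigr => b _; rewrite chiM.
rewrite big_pred0 ?mulr0 // => a; apply/negbTE/negP => /dvdp_leq.
have sX : size ('X^i + polyn a) = i.+1.
  by rewrite size_polyDl size_polyXn // ltnS size_npoly.
rewrite -size_poly_eq0 sX size_g => /(_ isT).
by rewrite ltnS leqNgt i_n.
Qed.

(** The coefficient of r that the weight reads is free, and psi sums to zero over F. *)
Lemma monic_weight_sum_eq0 j : (j < n)%N -> \sum_(r : {poly_n F}) monic_weight psi g n j r = 0.
Proof.
move=> jn; transitivity (\sum_(r : {poly_(n - j).-1.+1 F}) psi (polyn r)`_(n.-1 - j)).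
  rewrite prednK ?subn_gt0 // -(npoly_sum_widen (fun r => psi r`_(n.-1 - j)) (leq_subr j n)).
  rewrite [RHS]big_mkcond; apply: eq_bigr => r _ /=.
  by rewrite (monic_weight_lt _ g_monic size_g) ?size_npoly //; case: leqP; rewrite ?mul1r ?mul0r.
have -> : (n.-1 - j = (n - j).-1)%N by lia.
rewrite (npoly_sumS _ (fun r : {poly F} => psi r`_((n - j).-1))).
transitivity (\sum_(x : F) \sum_(a : {poly_((n - j).-1) F}) psi x).
  apply: eq_bigr => x _; apply: eq_bigr => a _.
  by rewrite coefD coefZ coefXn eqxx mulr1 [X in _ + X]nth_default ?size_npoly // addr0.
by rewrite exchange_big big1 // => a _; exact: (psi_sum psiP).
Qed.

(** For i at least n + k the weight keeps only t = 0, where the phase is trivial; the sum over r is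
    then zero by [monic_weight_sum_eq0]. *)
Lemma twisted_sum_vanish c cb i j : g %| cb * (l * c) - 1 ->
  (n + k <= i)%N -> (j < n)%N -> twisted_sum g chi c i j = 0.
Proof.
move=> hcb Ni jn; apply: (mulfI (expf_neq0 (n + k) q0)).
rewrite (twisted_sumE _ _ hcb) mulr0.
rewrite [X in _ * X]big1 ?mulr0 // => t _.
under eq_bigr => r _ do rewrite monic_weight_ge //.
have [t0|t0] := eqVneq (- polyn t) 0; last first.
  by apply: big1 => r _; rewrite mul0r mulr0.
have {t0} t0 : polyn t = 0 by apply/eqP; rewrite -oppr_eq0 t0.
under eq_bigr => r _ do rewrite t0 mulr0 mul0r efrac0 // mul1r mulr1.
by rewrite -mulr_sumr monic_weight_sum_eq0 ?mulr0.
Qed.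

End TwistedSums.

(** * The functional equation of the rational functions *)

Section Weights.
Context {F : finFieldType} {K : numFieldType}.
Variable psi : F -> K.
Hypothesis psi0 : psi 0 = 1.
Local Notation q := (#|F|%:R : K).
Implicit Types (t : {poly F}) (w : K).

(* The sum of w^A e_q(t_A) over all A >= deg t, with the geometric tail A > deg t
   summed formally. *)
Definition geom_weight w t : K :=
  if t == 0 then (1 - w)^-1
  else w ^+ (size t).-1 * (psi (lead_coef t) + w / (1 - w)).

Lemma geom_weight_sum w n t : 1 - w != 0 -> (size t <= n)%N ->
  \sum_(A < n) w ^+ A * ((size t <= A.+1)%N%:R * psi t`_A) = geom_weight w t - w ^+ n / (1 - w).
Proof.
move=> w1 st; rewrite -(subnKC st).
elim: (n - size t)%N => [|m IH].
  rewrite addn0 /geom_weight; case: eqP => [->|/eqP t0].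
    by rewrite size_poly0 big_ord0 expr0 div1r subrr.
  have : (0 < size t)%N by rewrite size_poly_gt0.
  rewrite lead_coefE; case Ds: (size t) => [//|s] _ /=.
  rewrite big_ord_recr /= leqnn mul1r big1 ?add0r; last first.
    by move=> i _; rewrite ltnS leqNgt ltn_ord mul0r mulr0.
  by rewrite exprS; field.
rewrite addnS big_ord_recr /= IH (leqW (leq_addr _ _)) mul1r.
by rewrite nth_default ?leq_addr // psi0 exprS; field.
Qed.

(** Reversing i to A = n - 1 - i turns (q u)^i into (q u)^n w^(A + 1) and makes the weight read the
    coefficient of index A. *)
Lemma monic_weight_generating (m t : {poly F}) (u w : K) n : m \is monic -> size m = n.+1 ->
  (size t <= n)%N -> 1 - w != 0 -> q * u * w = 1 ->
  \sum_(i < n) (q * u) ^+ i * monic_weight psi m n i t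
  = (q * u) ^+ n * w * (geom_weight w t - w ^+ n / (1 - w)).
Proof.
move=> mm sm st w1 quw; rewrite -geom_weight_sum // mulr_sumr (reindex_inj rev_ord_inj) /=.
apply: eq_bigr => i _; have i_n : (i < n)%N := ltn_ord i.
rewrite (monic_weight_lt _ mm sm) //; last by lia.
have -> : (n - (n - i.+1) = i.+1)%N by lia.
have -> : (n.-1 - (n - i.+1) = i)%N by lia.
rewrite [in RHS]mulrA; congr (_ * _).
have -> : (q * u) ^+ n = (q * u) ^+ (n - i.+1) * (q * u) ^+ i.+1 by rewrite -exprD subnK.
transitivity ((q * u) ^+ (n - i.+1) * (q * u * w) ^+ i.+1).
  by rewrite quw expr1n mulr1.
by rewrite [(q * u * w) ^+ _]exprMn [w ^+ i.+1]exprS; ring.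
Qed.

(** The weight sees only the degree and the leading coefficient; the bracket is the factor from
    which [qB2] is built. *)
Lemma geom_weight_scale w (x : F) i (a : {poly_i F}) : x != 0 ->
  geom_weight w (x *: ('X^i + polyn a)) = w ^+ i * (psi x + w / (1 - w)).
Proof.
move=> x0; have sX : size ('X^i + polyn a) = i.+1.
  by rewrite size_polyDl size_polyXn // ltnS size_npoly.
rewrite /geom_weight -size_poly_eq0 size_scale // sX /= lead_coefE coefZ size_scale // sX /=.
by rewrite coefD coefXn eqxx (nth_default _ (size_npoly a)) addr0 mulr1.
Qed.

End Weights.

Section Functional.
Context {F : finFieldType} {K : numFieldType}.
Variable psi : F -> K.
Local Notation q := (#|F|%:R : K).
Implicit Types (g l c : {poly F}) (chi : {poly F} -> K).

Definition finite_part g chi c N n u : K :=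
  \sum_(i < N) \sum_(j < n) twisted_sum psi g chi c i j * u ^+ (i + j).

Definition L_finite chi k u : K := \sum_(a < k) monic_sum chi a * u ^+ a.

(* The Dirichlet L-series of chi: a polynomial of degree < deg ell, except that
   ell = 1 gives 1 / (1 - q u). *)
Definition L_rat l chi u : K :=
  L_finite chi (size l).-1 u + (size l == 1%N)%:R / (1 - q * u).

(* The second summand collects the coefficients with i, j >= deg g. *)
Definition R2_rat g l chi c u : K :=
  finite_part g chi c ((size g).-1 + (size l).-1) (size g).-1 u
  + chi g * (q * u ^+ 2) ^+ (size g).-1 * L_rat l chi u / (1 - q * u).

(* q times B_x at v = - 1 / (1 - q u): the four Kloosterman sums factor under the
   sum over z. *)
Definition qB2 chi (x : F) (v : K) : K :=
  \sum_(z : F | z != 0) chi z%:P * (psi (- z) + v) * (psi (x / z) + v).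

End Functional.

(** * The duality between u and w = 1 / (q u) *)

Section FunctionalEquation.
Context {F : finFieldType} {K : numFieldType}.
Variable psi : F -> K.
Hypothesis psiP : nontrivial_character psi.
Let psiD := ncharD psiP.
Let psi0 := nchar0 psiP.
Let psi_nontriv := nchar_neq1 psiP.
Variables (l : {poly F}) (k : nat).
Hypothesis l_monic : l \is monic.
Hypothesis size_l : size l = k.+1.
Variables chi chib : {poly F} -> K.
Hypothesis chiP : primitive_pair l chi chib.
Let chiM := pairM chiP.
Let chi_mod := pair_mod chiP.
Let chibM := pairbM chiP.
Let chib_mod := pairb_mod chiP.
Let chib_ncop := pairb_ncop chiP.
Let chi_chib := pair_inv chiP.
Let chi_prim := pair_prim chiP.
Variables (g : {poly F}) (n : nat).
Hypothesis g_monic : g \is monic.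
Hypothesis size_g : size g = n.+1.
Hypothesis gl : coprimep g l.
Variables c cb : {poly F}.
Hypothesis hcb : g %| cb * (l * c) - 1.
Local Notation q := (#|F|%:R : K).
Local Notation E := (efrac psi).
Local Notation G := (gauss_sum psi l k chi).
Variables u w : K.
Hypothesis w1 : 1 - w != 0.
Hypothesis quw : q * u * w = 1.
Local Notation wt := (geom_weight psi w).
Local Notation v := (w / (1 - w)).

Let g0 : g != 0. Proof. exact: monic_neq0. Qed.
Let l0 : l != 0. Proof. exact: monic_neq0. Qed.
Let gl_monic : g * l \is monic. Proof. by rewrite monicMl. Qed.
Let size_gl : size (g * l) = (n + k).+1.
Proof. by rewrite size_mul // size_g size_l addnS. Qed.
Let q0 : q != 0. Proof. by rewrite pnatr_eq0 -lt0n; apply/card_gt0P; exists 0. Qed.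

Let coprime_g_cb : coprimep g cb.
Proof.
rewrite coprimep_sym; apply/Bezout_coprimepP.
case/dvdpP: hcb => z Dz; exists (l * c, - z) => /=.
rewrite mulNr -Dz mulrC opprB addrC subrK; exact: eqpxx.
Qed.

Let phi t r := chib t * E g (cb * t * r).

(* phi weighted by the sums of w^A e_q(- t_A), deg t <= A < n + k, and of
   w^B e_q(r_B), deg r <= B < n. *)
Definition truncated_sum := \sum_(t : {poly_(n + k) F}) \sum_(r : {poly_n F})
  phi t r * ((wt (- polyn t) - w ^+ (n + k) / (1 - w)) * (wt r - w ^+ n / (1 - w))).

Lemma finite_part_truncated :
  q ^+ (n + k) * finite_part psi g chi c (n + k) n u
  = chi g * G * ((q * u) ^+ (n + k) * (q * u) ^+ n * w ^+ 2) * truncated_sum.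
Proof.
rewrite /finite_part mulr_sumr.
transitivity (\sum_(i < n + k) \sum_(j < n) \sum_(t : {poly_(n + k) F}) \sum_(r : {poly_n F})
  chi g * G * (phi t r * (((q * u) ^+ i * monic_weight psi (g * l) (n + k) i (- polyn t))
     * ((q * u) ^+ j * monic_weight psi g n j r)))).
  apply: eq_bigr => i _; rewrite mulr_sumr; apply: eq_bigr => j _.
  rewrite mulrA (twisted_sumE psiP l_monic size_l chiP g_monic size_g gl _ _ hcb).
  rewrite [LHS]mulrAC mulr_sumr; apply: eq_bigr => t _.
  rewrite mulr_sumr; apply: eq_bigr => r _.
  by rewrite !exprMn !exprD /phi; ring.
transitivity (\sum_(t : {poly_(n + k) F}) \sum_(r : {poly_n F}) chi g * G * (phi t r *
   ((\sum_(i < n + k) (q * u) ^+ i * monic_weight psi (g * l) (n + k) i (- polyn t))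
     * (\sum_(j < n) (q * u) ^+ j * monic_weight psi g n j r)))).
  under eq_bigr => i _ do rewrite exchange_big.
  rewrite exchange_big; apply: eq_bigr => t _ /=.
  under eq_bigr => i _ do rewrite exchange_big.
  rewrite exchange_big; apply: eq_bigr => r _ /=.
  rewrite big_distrlr /= !mulr_sumr; apply: eq_bigr => i _.
  by rewrite !mulr_sumr.
rewrite /truncated_sum [RHS]mulr_sumr; apply: eq_bigr => t _.
rewrite [RHS]mulr_sumr; apply: eq_bigr => r _.
rewrite (monic_weight_generating psi0 gl_monic size_gl _ w1 quw) ?size_polyN ?size_npoly //.
by rewrite (monic_weight_generating psi0 g_monic size_g _ w1 quw) ?size_npoly //; ring.
Qed.

Lemma phi_sum_r t : \sum_(r : {poly_n F}) phi t r = (g %| t)%R%:R * q ^+ n * chib t.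
Proof.
rewrite /phi -mulr_sumr (efrac_orthogonality psiP _ g_monic size_g).
by rewrite Gauss_dvdpr // mulrC.
Qed.

(** With t = l b + a the sum over b is an orthogonality sum modulo g, and cb l is prime to g, so
    only r = 0 remains. *)
Lemma phi_sum_t (r : {poly_n F}) : \sum_(t : {poly_(n + k) F}) phi t r
  = (polyn r == 0)%:R * q ^+ n * \sum_(a : {poly_k F}) chib a.
Proof.
rewrite addnC (npoly_sum_edivp n (fun t => phi t r) l_monic size_l).
rewrite exchange_big mulr_sumr; apply: eq_bigr => a _ /=.
transitivity (\sum_(b : {poly_n F}) chib a * E g (cb * a * r) * E g (cb * l * polyn r * b)).
  apply: eq_bigr => b _; rewrite /phi -[RHS]mulrA -efracD //.
  congr (_ * E g _); last by ring.
  by apply: chib_mod; rewrite addrK dvdp_mulr.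
rewrite -mulr_sumr (efrac_orthogonality psiP _ g_monic size_g).
have -> : (g %| cb * l * r) = (polyn r == 0).
  rewrite Gauss_dvdpr ?coprimepMr ?coprime_g_cb //.
  by rewrite /dvdp modp_small // size_g ltnS size_npoly.
case: eqP => [->|_]; last by rewrite !mul0r mulr0.
by rewrite mulr0 efrac0 // mulr1 mulrC.
Qed.

(** A nonzero sum makes the character trivial on everything prime to l; primitivity at the divisor 1
    then gives l = 1. *)
Lemma chib_sum : \sum_(a : {poly_k F}) chib a = (k == 0%N)%:R.
Proof.
have [chi1 chib1] := chi1_neq0 chiP.
case: (posnP k) => [k0|k0].
  move: (character_mod1 size_l chibM chib_mod chib1 k0) => chibE.
  under eq_bigr => a _ do rewrite chibE.
  by rewrite npoly_sum_const k0.
apply/eqP; apply: contraTT isT => sum0.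
have : 1 = l.
  apply: chi_prim; rewrite ?monic1 ?dvd1p // => f fl _.
  have : chib f * \sum_(a : {poly_k F}) chib a = \sum_(a : {poly_k F}) chib a.
    rewrite -[RHS](@npoly_sum_mod _ _ l k (fun a => f * a) chib) //.
      by rewrite mulr_sumr; apply: eq_bigr => a _; rewrite chibM.
    by move=> a b; rewrite -mulrBr Gauss_dvdpr // coprimep_sym.
  rewrite -[RHS]mul1r => /(mulIf sum0) cf.
  by rewrite -(chi_chib fl) cf mulr1.
move/(congr1 (fun p : {poly F} => size p)); rewrite size_poly1 size_l => -[E0].
by rewrite -E0 in k0.
Qed.

Definition weighted_char_sum N := \sum_(t : {poly_N F}) chib t * wt (- polyn t).

Definition dual_sum := \sum_(t : {poly_(n + k) F}) \sum_(r : {poly_n F}) phi t r * (wt (- polyn t) * wt r).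

(** The tail of the r-weight does not depend on r, so [phi_sum_r] reduces it to multiples of g. The
    tail of the t-weight, against the truncated r-weight, is reduced by [phi_sum_t] to r = 0 and is
    nonzero only for k = 0. *)
Lemma truncated_sumE : truncated_sum = dual_sum
  - w ^+ n / (1 - w) * q ^+ n * chib g * \sum_(b : {poly_k F}) chib b * wt (- (g * b))
  - (k == 0%N)%:R * q ^+ n * w ^+ (n + k) / (1 - w) * ((1 - w ^+ n) / (1 - w)).
Proof.
have -> : truncated_sum = dual_sum
   - w ^+ n / (1 - w) * \sum_(t : {poly_(n + k) F}) (\sum_(r : {poly_n F}) phi t r) * wt (- polyn t)
   - w ^+ (n + k) / (1 - w) * \sum_(r : {poly_n F}) (\sum_(t : {poly_(n + k) F}) phi t r) * (wt r - w ^+ n / (1 - w)).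
  under [X in _ = _ - _ * X]eq_bigr => r _ do rewrite mulr_suml.
  rewrite exchange_big /truncated_sum /dual_sum !mulr_sumr -!sumrB; apply: eq_bigr => t _ /=.
  rewrite mulr_suml !mulr_sumr -!sumrB; apply: eq_bigr => r _; ring.
congr (_ - _ - _).
  rewrite -!mulrA; congr (_ * (_ * _)).
  transitivity (q ^+ n * \sum_(t : {poly_(n + k) F} | g %| t) chib t * wt (- polyn t)).
    rewrite mulr_sumr [RHS]big_mkcond /=; apply: eq_bigr => t _.
    by rewrite phi_sum_r; case: (g %| _); rewrite ?mul0r // mul1r mulrA.
  congr (_ * _); rewrite big_mkcond /=.
  rewrite (npoly_sum_edivp k (fun t => if g %| t then chib t * wt (- t) else 0) g_monic size_g).
  rewrite mulr_sumr; apply: eq_bigr => b _.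
  rewrite (bigD1 (0 : {poly_n F})) //= addr0 dvdp_mulr // chibM mulrA big1 ?addr0 // => a a0.
  rewrite dvdp_addr ?dvdp_mulr // /dvdp modp_small ?size_g ?ltnS ?size_npoly //.
  by case: eqP => // E0; case/negP: a0; apply/eqP/val_inj.
rewrite (bigD1 (0 : {poly_n F})) //= [X in _ * (_ + X)]big1 ?addr0 => [|r r0]; last first.
  by rewrite phi_sum_t -[polyn r == 0]/(r == 0) (negPf r0) !mul0r.
rewrite (phi_sum_t 0) chib_sum /geom_weight eqxx mul1r.
by field.
Qed.

Lemma psi_shift_sum : \sum_(x : F | x != 0) (psi x + v) = -1 + (q - 1) * v.
Proof.
have := psi_sum psiP; rewrite (bigD1 0) //= psi0 => /eqP.
rewrite addrC addr_eq0 => /eqP s1.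
rewrite big_split /= s1; congr (_ + _).
have : \sum_(x : F) v = q * v by rewrite sumr_const -[LHS]mulr_natl.
by rewrite (bigD1 0) //= mulrBl mul1r => <-; rewrite addrAC subrr add0r.
Qed.

Lemma geom_weight_sum_all N : \sum_(r : {poly_N F}) wt r = (q * w) ^+ N / (1 - w).
Proof.
rewrite npoly_sum_degree /geom_weight eqxx.
elim: N => [|N IH]; first by rewrite big_ord0 expr0 addr0 div1r.
rewrite big_ord_recr /= addrA IH.
transitivity ((q * w) ^+ N / (1 - w) + q ^+ N * w ^+ N * \sum_(x : F | x != 0) (psi x + v)).
  congr (_ + _); rewrite mulr_sumr; apply: eq_bigr => x x0.
  under eq_bigr => a _ do rewrite -/(geom_weight psi w _) geom_weight_scale //.
  by rewrite npoly_sum_const -[LHS]mulr_natl natrX mulrA.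
rewrite psi_shift_sum.
by rewrite exprS exprMn; field.
Qed.

(** For psi = [e_q] this is [tau] of chib at -1 plus v times the sum of chib over the nonzero
    constants. *)
Let shifted_tau := \sum_(x : F | x != 0) chib x%:P * (psi (- x) + v).

Lemma weighted_char_sumE N : weighted_char_sum N = chib 0 / (1 - w) + L_finite chib N w * shifted_tau.
Proof.
rewrite /weighted_char_sum (npoly_sum_degree _ (fun t => chib t * wt (- t))) oppr0 /geom_weight eqxx.
congr (_ + _); rewrite /L_finite mulr_suml; apply: eq_bigr => a _.
rewrite /shifted_tau mulr_sumr; apply: eq_bigr => x x0.
rewrite /monic_sum !mulr_suml; apply: eq_bigr => d _.
rewrite -scaleNr -/(geom_weight psi w _) geom_weight_scale ?oppr_eq0 //.
by rewrite -mul_polyC chibM; ring.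
Qed.

Let main_sum := \sum_(x : F | x != 0) qB2 psi chib x v
  * finite_part psi g chib (x *: cb) (n + k) n w.

Lemma main_sumE : \sum_(a < n + k) \sum_(x : F | x != 0) \sum_(d : {poly_a F})
  \sum_(b < n) \sum_(y : F | y != 0) \sum_(m : {poly_b F})
   phi (x *: ('X^a + polyn d)) (y *: ('X^b + polyn m)) *
    (wt (- (x *: ('X^a + polyn d))) * wt (y *: ('X^b + polyn m))) = main_sum.
Proof.
(* In [Q] the letter y is the product of the two leading coefficients, which is all that the phase
   sees of them. For fixed y the sum over x is [qB2]. *)
pose Q (x y : F) a b (d : {poly_a F}) (m : {poly_b F}) :=
   chib x%:P * (psi (- x) + v) * (psi (y / x) + v) *
   (chib ('X^a + polyn d) * E g (y *: cb * ('X^a + polyn d) * ('X^b + polyn m)) * w ^+ (a + b)).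
transitivity (\sum_(a < n + k) \sum_(x : F | x != 0) \sum_(d : {poly_a F})
  \sum_(b < n) \sum_(y : F | y != 0) \sum_(m : {poly_b F}) Q x y a b d m).
  apply: eq_bigr => a _; apply: eq_bigr => x x0; apply: eq_bigr => d _.
  apply: eq_bigr => b _; rewrite [RHS](reindex_inj (mulIf x0)) /=.
  apply: eq_big => [y|y y0]; first by rewrite mulf_eq0 (negPf x0) orbF.
  apply: eq_bigr => m _; rewrite /Q /phi -scaleNr !geom_weight_scale ?oppr_eq0 //.
  rewrite mulfK // -!mul_polyC chibM polyCM.
  have -> : cb * (x%:P * ('X^a + polyn d)) * (y%:P * ('X^b + polyn m))
    = y%:P * x%:P * cb * ('X^a + polyn d) * ('X^b + polyn m) by ring.
  by rewrite exprD; ring.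
transitivity (\sum_(y : F | y != 0) \sum_(x : F | x != 0) \sum_(a < n + k) \sum_(b < n)
   \sum_(d : {poly_a F}) \sum_(m : {poly_b F}) Q x y a b d m).
  rewrite exchange_big [RHS]exchange_big /=; apply: eq_bigr => x x0.
  rewrite [RHS]exchange_big /=; apply: eq_bigr => a _.
  under [X in X = _]eq_bigr => d _ do rewrite exchange_big.
  rewrite [LHS]exchange_big; apply: eq_bigr => y _ /=.
  by rewrite exchange_big.
rewrite /main_sum /qB2 /finite_part; apply: eq_bigr => y _.
rewrite mulr_suml; apply: eq_bigr => x _.
rewrite !mulr_sumr; apply: eq_bigr => a _; rewrite !mulr_sumr; apply: eq_bigr => b _.
rewrite /twisted_sum mulr_suml mulr_sumr; apply: eq_bigr => d _.
by rewrite mulr_suml mulr_sumr; apply: eq_bigr => m _.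
Qed.

(** The three terms come from t = 0, from r = 0 with t nonzero, and from both nonzero. *)
Lemma dual_sumE : dual_sum = chib 0 / (1 - w) * ((q * w) ^+ n / (1 - w))
  + L_finite chib (n + k) w * shifted_tau / (1 - w) + main_sum.
Proof.
have phr0 t : phi t 0 = chib t by rewrite /phi mulr0 efrac0 // mulr1.
have ph0r r : phi 0 r = chib 0 by rewrite /phi mulr0 mul0r efrac0 // mulr1.
rewrite /dual_sum (npoly_sum_degree _ (fun t => \sum_(r : {poly_n F}) phi t r * (wt (- t) * wt r))).
rewrite -addrA; congr (_ + _).
  rewrite -geom_weight_sum_all mulr_sumr; apply: eq_bigr => r _.
  by rewrite ph0r oppr0 {1}/geom_weight eqxx mulrA.
have Zp : L_finite chib (n + k) w * shifted_tau = \sum_(a < n + k) \sum_(x : F | x != 0)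
    \sum_(d : {poly_a F}) chib (x *: ('X^a + polyn d)) * wt (- (x *: ('X^a + polyn d))).
  apply: (addrI (chib 0 / (1 - w))); rewrite -weighted_char_sumE /weighted_char_sum.
  by rewrite (npoly_sum_degree _ (fun t => chib t * wt (- t))) oppr0 {1}/geom_weight eqxx.
rewrite Zp -main_sumE mulr_suml -big_split; apply: eq_bigr => a _ /=.
rewrite mulr_suml -big_split; apply: eq_bigr => x _ /=.
rewrite mulr_suml -big_split; apply: eq_bigr => d _ /=.
set t := _ *: _.
rewrite (npoly_sum_degree _ (fun r => phi t r * (wt (- t) * wt r))) phr0; congr (_ + _).
by rewrite {2}/geom_weight eqxx mulrA.
Qed.

(** For fixed z the quotient x / z runs over all nonzero constants, so the double sum factors. *)
Lemma qB2_sum : \sum_(x : F | x != 0) qB2 psi chib x v = shifted_tau * (-1 + (q - 1) * v).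
Proof.
rewrite /qB2 exchange_big /shifted_tau mulr_suml; apply: eq_bigr => z z0 /=.
rewrite -mulr_sumr; congr (_ * _); rewrite -psi_shift_sum.
rewrite [RHS](reindex_inj (mulIf (invr_neq0 z0))) /=; apply: eq_bigl => x.
by rewrite mulf_eq0 invr_eq0 (negPf z0) orbF.
Qed.

Lemma R2_rat_sum : \sum_(x : F | x != 0) qB2 psi chib x v * R2_rat psi g l chib (x *: cb) w
  = main_sum + shifted_tau * (-1 + (q - 1) * v) * (chib g * (q * w ^+ 2) ^+ n * L_rat l chib w / (1 - q * w)).
Proof.
rewrite -qB2_sum mulr_suml /main_sum -big_split; apply: eq_bigr => x _ /=.
by rewrite /R2_rat size_g size_l mulrDr.
Qed.

(** Poisson summation for chi alone; the tail of the truncated weight is multiplied by [chib_sum],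
    which is 0 for k > 0. *)
Lemma L_finite_functional : (0 < k)%N ->
  q ^+ k * L_finite chi k u = G * ((q * u) ^+ k * w) * weighted_char_sum k.
Proof.
move=> k0; transitivity (G * \sum_(t : {poly_k F}) chib t *
    \sum_(i < k) (q * u) ^+ i * monic_weight psi l k i (- polyn t)); last first.
  rewrite -mulrA; congr (_ * _).
  transitivity ((q * u) ^+ k * w * \sum_(t : {poly_k F})
     (chib t * wt (- polyn t) - chib t * (w ^+ k / (1 - w)))).
    rewrite mulr_sumr; apply: eq_bigr => t _.
    by rewrite (monic_weight_generating psi0 l_monic size_l _ w1 quw) ?size_polyN ?size_npoly //; ring.
  by rewrite sumrB -mulr_suml chib_sum gtn_eqF // mul0r subr0.
rewrite /L_finite mulr_sumr.
transitivity (\sum_(i < k) \sum_(t : {poly_k F}) G * (chib t *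
    ((q * u) ^+ i * monic_weight psi l k i (- polyn t)))).
  apply: eq_bigr => i _.
  rewrite mulrA (monic_sumE psiP l_monic size_l chiP) [LHS]mulrAC [LHS]mulr_sumr; apply: eq_bigr => t _.
  by rewrite exprMn; ring.
rewrite exchange_big [RHS]mulr_sumr; apply: eq_bigr => t _ /=.
by rewrite -!mulr_sumr.
Qed.

Lemma L_finite_trunc N : (0 < k)%N -> (k <= N)%N -> L_finite chib N w = L_finite chib k w.
Proof.
move=> k0 kN; rewrite /L_finite -(big_mkord xpredT (fun a => monic_sum chib a * w ^+ a)).
rewrite (big_cat_nat (leq0n k) kN) //= big_mkord [X in _ + X]big_nat_cond.
rewrite [X in _ + X]big1 ?addr0 // => a /andP[/andP[ka _] _].
rewrite (monic_sum_ge psiP l_monic size_l (primitive_pair_sym chiP)) //.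
by rewrite gtn_eqF // !mul0r.
Qed.

(** The bilinear sum [main_sum] occurs on both sides with the same factor. For k > 0, after
    [L_finite_functional], every other term is a multiple of L(w, chib) [shifted_tau], and the
    coefficients agree as rational functions. *)
Lemma functional_equation : (0 < n)%N -> 1 - q * w != 0 ->
  R2_rat psi g l chi c u
  = chi g * G * (q * u ^+ 2) ^+ (n - 1) * u ^+ k
    * (q^-1 * \sum_(x : F | x != 0) qB2 psi chib x v * R2_rat psi g l chib (x *: cb) w).
Proof.
move=> n0 qw1; rewrite R2_rat_sum /R2_rat size_g size_l /=.
have w0 : w != 0 by apply: contra_eq_neq quw => ->; rewrite mulr0 eq_sym oner_eq0.
have Du : u = (q * w)^-1.
  by apply: (mulIf (mulf_neq0 q0 w0)); rewrite mulVf ?mulf_neq0 // mulrCA mulrA quw.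
have Dqu : q * u = w^-1 by rewrite Du; field; rewrite w0 q0.
have qu1 : 1 - w^-1 != 0.
  rewrite -(inj_eq (mulfI w0)) mulr0 mulrBr mulfV // mulr1 subr_eq0 eq_sym -subr_eq0.
  exact: w1.
have P_X := finite_part_truncated; rewrite Dqu in P_X.
have {P_X} P_X : finite_part psi g chi c (n + k) n u
  = chi g * G * (w^-1 ^+ (n + k) * w^-1 ^+ n * w ^+ 2) * truncated_sum / q ^+ (n + k).
  by apply: (mulfI (expf_neq0 (n + k) q0)); rewrite P_X [RHS]mulrC mulfVK ?expf_neq0.
have Dn : n = (n - 1).+1 by rewrite subn1 prednK.
have A0 : q ^+ (n - 1) != 0 by rewrite expf_neq0.
have B0 : w ^+ (n - 1) != 0 by rewrite expf_neq0.
have C0 : q ^+ k != 0 by rewrite expf_neq0.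
have D0 : w ^+ k != 0 by rewrite expf_neq0.
have nE x : x ^+ n = x * x ^+ (n - 1) :> K by rewrite {1}Dn exprS.
have w1' : w - 1 != 0 by rewrite -opprB oppr_eq0.
(* For k = 0 the characters are constantly 1, so chib 0 does not vanish and all terms but [main_sum]
   become explicit. *)
case: (posnP k) => [k0|k0]; last first.
  have c0 : chib 0 = 0 := chib_eq0 size_l chiP k0.
  have Zk : weighted_char_sum k = L_finite chib k w * shifted_tau by rewrite weighted_char_sumE c0 mul0r add0r.
  have LF := L_finite_functional k0; rewrite Dqu in LF.
  have {LF} LF : L_finite chi k u = G * (w^-1 ^+ k * w) * (L_finite chib k w * shifted_tau) / q ^+ k.
    by apply: (mulfI C0); rewrite LF Zk [RHS]mulrC mulfVK.
  have Zg : \sum_(b : {poly_k F}) chib b * wt (- (g * b)) = w ^+ n * weighted_char_sum k.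
    rewrite /weighted_char_sum mulr_sumr; apply: eq_bigr => b _.
    have [->|b0] := eqVneq (polyn b) 0; first by rewrite c0 !mul0r mulr0.
    have gb0 : g * b != 0 by rewrite mulf_neq0.
    rewrite /geom_weight !oppr_eq0 (negPf gb0) (negPf b0) !size_polyN !lead_coefN.
    rewrite lead_coefM (monicP g_monic) mul1r size_mul // size_g /=.
    have : (0 < size b)%N by rewrite size_poly_gt0.
    case: (size b) => // s _; rewrite addnS /= exprD; ring.
  have chig : chi g * chib g = 1 by rewrite chi_chib.
  rewrite P_X truncated_sumE dual_sumE Zg Zk c0 L_finite_trunc ?leq_addl // /L_rat size_l gtn_eqF //=.
  rewrite LF eqSS gtn_eqF // Dqu Du.
  set Lb := L_finite chib k w; clearbody Lb main_sum shifted_tau.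
  have -> : chib g = (chi g)^-1.
    by rewrite -[RHS]mul1r -chig [chi g * _]mulrC mulfK //;
      apply: contra_eq_neq chig => ->; rewrite mul0r eq_sym oner_eq0.
  have cg0 : chi g != 0.
    by apply: contra_eq_neq chig => ->; rewrite mul0r eq_sym oner_eq0.
  rewrite !exprD !exprMn !exprVn !exprMn !nE.
  (* The powers become indeterminates; n - 1 is the common exponent because the right-hand side
     contains (q u^2)^(n - 1). *)
  move: (q ^+ (n - 1)) (w ^+ (n - 1)) (q ^+ k) (w ^+ k) A0 B0 C0 D0 => A B C D A0 B0 C0 D0.
  rewrite /= mulr0n; field.
  by rewrite A0 B0 C0 D0 cg0 q0 qw1 w0 w1 w1'.
have kE (f : {poly F} -> K) : (forall a b, f (a * b) = f a * f b) ->
  (forall a b, l %| a - b -> f a = f b) -> f 1 != 0 -> forall a, f a = 1.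
  by move=> *; apply: (character_mod1 size_l).
have [chi1 chib1] := chi1_neq0 chiP.
have chiE := kE _ chiM chi_mod chi1; have chibE := kE _ chibM chib_mod chib1.
have G1 : gauss_sum psi l 0 chi = 1.
  by rewrite /gauss_sum (npoly_sum0 (fun a => chi a * E l a)) chiE efrac0 // mulr1.
have TE : shifted_tau = -1 + (q - 1) * v.
  rewrite /shifted_tau -psi_shift_sum; rewrite (reindex_inj oppr_inj) /=.
  by apply: eq_big => [x|x _]; rewrite ?oppr_eq0 // chibE mul1r opprK.
have ZE : weighted_char_sum n = (q * w) ^+ n / (1 - w).
  rewrite -geom_weight_sum_all /weighted_char_sum [RHS](reindex_inj oppr_inj) /=.
  by apply: eq_bigr => t _; rewrite chibE mul1r.
have LE : L_finite chib n w * shifted_tau = ((q * w) ^+ n - 1) / (1 - w).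
  apply: (addrI (chib 0 / (1 - w))); rewrite -weighted_char_sumE ZE chibE; ring.
rewrite P_X truncated_sumE dual_sumE k0 addn0 LE.
rewrite (npoly_sum0 (fun b => chib b * wt (- (g * b)))) mulr0 oppr0 !chibE !chiE G1.
rewrite /geom_weight !eqxx /L_rat size_l k0 /L_finite !big_ord0 TE Dqu Du.
clearbody main_sum.
rewrite ?exprD !exprMn !exprVn !exprMn !nE.
move: (q ^+ (n - 1)) (w ^+ (n - 1)) A0 B0 => A B A0 B0.
rewrite /= ?mulr1n.
field.
by rewrite A0 B0 q0 qw1 w0 w1 w1'.
Qed.

End FunctionalEquation.

(** * Power series and meromorphic functions *)

Section ComplexTopology.
Context {R : realType}.
Local Notation C := R[i]^o.
Implicit Types (z w e : C) (f h : C -> C).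

Lemma cvgCP (u : nat -> C) (l : C) :
  u @ \oo --> l <-> forall e, 0 < e -> exists N, forall n, (N <= n)%N -> `|l - u n| < e.
Proof.
split=> [/cvgrPdist_lt h e e0|h].
  by have [N _ hN] := h e e0; exists N => n; exact: hN.
by apply/cvgrPdist_lt => e /h[N hN]; exists N.
Qed.

Lemma nearCP z (P : C -> Prop) :
  (\forall w \near z, P w) <-> exists2 e, 0 < e & forall w, `|z - w| < e -> P w.
Proof.
split=> [/nbhs_normP[e e0 h]|[e e0 h]]; first by exists e => // w; exact: h.
by apply/nbhs_normP; exists e => // w; exact: h.
Qed.

Lemma dnearCP z (P : C -> Prop) :
  (\forall w \near z^', P w) <->
  exists2 e, 0 < e & forall w, `|z - w| < e -> w != z -> P w.
Proof.
split=> [/nearCP[e e0 h]|[e e0 h]]; first by exists e => // w zw wz; exact: h.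
by apply/nearCP; exists e => // w zw wz; exact: h.
Qed.

Lemma near_dnear z (P : C -> Prop) : (\forall w \near z, P w) -> \forall w \near z^', P w.
Proof. by move=> /nearCP[e e0 h]; apply/dnearCP; exists e => // w zw _; exact: h. Qed.

(** The order on R[i] compares only numbers with equal imaginary part. *)
Lemma posC_real e : 0 < e -> exists2 r : R, 0 < r & e = (r%:C)%C.
Proof.
move=> e0; have re : e \is Num.real by apply: gtr0_real.
exists (complex.Re e); last by rewrite RRe_real.
by move: e0; rewrite -{1}(RRe_real re) ltcR.
Qed.

Lemma normC_real z : exists2 r : R, 0 <= r & `|z| = (r%:C)%C.
Proof. by rewrite normc_def; eexists; last reflexivity; exact: sqrtr_ge0. Qed.

Lemma expC_cvg0 (x : C) : `|x| < 1 -> (fun n => x ^+ n) @ \oo --> (0 : C).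
Proof.
move=> x1; apply/cvgCP => e /posC_real[d d0 ->].
have [r r0 Dr] := normC_real x; have r1 : r < 1 by rewrite -ltcR -Dr.
have /cvgrPdist_lt/(_ d d0)[N _ hN] : (fun n => r ^+ n) @ \oo --> (0 : R).
  by apply: cvg_expr; rewrite ger0_norm.
exists N => n Nn; have := hN n Nn.
by rewrite !sub0r !normrN ger0_norm ?exprn_ge0 // normrX Dr -rmorphXn ltcR.
Qed.

Lemma proper_dnear z (P : C -> Prop) : (\forall w \near z^', P w) -> exists2 w, w != z & P w.
Proof.
move=> /dnearCP[e e0 h]; exists (z + e / 2).
  by rewrite -subr_eq0 addrAC subrr add0r mulf_neq0 ?gt_eqF // invr_neq0 // pnatr_eq0.
apply: h.
  rewrite opprD addrA subrr sub0r normrN ger0_norm ?divr_ge0 ?ltW //.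
  by rewrite ltr_pdivrMr // ltr_pMr // ltr1n.
by rewrite -subr_eq0 addrAC subrr add0r mulf_neq0 ?gt_eqF // invr_neq0 // pnatr_eq0.
Qed.

End ComplexTopology.

Section Analytic.
Context {R : realType}.
Local Notation C := R[i]^o.
Implicit Types (z w e : C) (f h : C -> C) (a b : nat -> C).

Definition psum a w (n : nat) : C := \sum_(k < n) a k * w ^+ k.

Lemma psumE a w : series (fun k => a k * w ^+ k) = psum a w.
Proof. by apply/funext => n; rewrite /series /= big_mkord. Qed.

Lemma analytic_atP f z : analytic_at f z <->
  exists a, \forall w \near z, psum a (w - z) @ \oo --> f w.
Proof.
by split=> -[a ha]; exists a; apply: filterS ha => w; rewrite psumE.
Qed.

Lemma cvg_psum_bound a w (l : C) : psum a w @ \oo --> l ->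
  exists2 B, 0 < B & forall k, `|a k * w ^+ k| <= B.
Proof.
move=> /cvgCP/(_ 1 ltr01)[N hN].
(* The sum bounds the terms before N; a later term is a difference of two partial sums within 1 of
   l. *)
exists (\sum_(k < N) `|a k * w ^+ k| + 2).
  by rewrite ltr_wpDl // sumr_ge0.
move=> k; have [kN|Nk] := ltnP k N.
  rewrite (bigD1 (Ordinal kN)) //= -addrA lerDl addr_ge0 ?sumr_ge0 //.
apply: ler_wpDl; first exact: sumr_ge0.
have -> : a k * w ^+ k = (l - psum a w k) - (l - psum a w k.+1).
  rewrite /psum big_ord_recr /=; ring.
rewrite (le_trans (ler_normB _ _)) // -[2]/(1 + 1) lerD // ltW // hN //; exact: leqW.
Qed.

Lemma analytic_bound f z (a : nat -> C) :
  (\forall w \near z, psum a (w - z) @ \oo --> f w) ->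
  exists r B : C, [/\ 0 < r, 0 < B & forall k, `|a k| <= B * r^-1 ^+ k].
Proof.
move=> /nearCP[e e0 h].
have e2 : 0 < e / 2 by rewrite divr_gt0.
have ze : `|z - (z + e / 2)| < e.
  rewrite opprD addrA subrr sub0r normrN ger0_norm ?ltW //.
  by rewrite ltr_pdivrMr // ltr_pMr // ltr1n.
have [B B0 hB] := cvg_psum_bound (h _ ze).
exists (e / 2), B; split=> // k.
have := hB k; rewrite addrAC subrr add0r normrM (ger0_norm (exprn_ge0 _ (ltW e2))) => hk.
by rewrite exprVn ler_pdivlMr // exprn_gt0.
Qed.

Lemma analytic_sub f h z : analytic_at f z -> analytic_at h z ->
  analytic_at (fun w => f w - h w) z.
Proof.
move=> /analytic_atP[a ha] /analytic_atP[b hb].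
apply/analytic_atP; exists (fun k => a k - b k).
apply: filterS2 ha hb => w aw bw; apply/cvgCP => e e0; have e2 : 0 < e / 2 by rewrite divr_gt0.
have /cvgCP/(_ _ e2)[N hN] := aw; have /cvgCP/(_ _ e2)[M hM] := bw.
exists (maxn N M) => n; rewrite geq_max => /andP[Nn Mn].
have -> : psum (fun k => a k - b k) (w - z) n = psum a (w - z) n - psum b (w - z) n.
  by rewrite /psum -sumrB; apply: eq_bigr => k _; rewrite mulrBl.
have -> : f w - h w - (psum a (w - z) n - psum b (w - z) n)
  = (f w - psum a (w - z) n) - (h w - psum b (w - z) n) by ring.
by rewrite (le_lt_trans (ler_normB _ _)) // [e]splitr ltrD ?hN ?hM.
Qed.

Lemma analytic_cst c z : analytic_at (fun=> c) z.
Proof.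
apply/analytic_atP; exists (fun k => if k is 0%N then c else 0).
apply: filterE => w; apply/cvgCP => e e0; exists 1%N => -[//|n] _.
by rewrite /psum big_ord_recl expr0 mulr1 big1 ?addr0 ?subrr ?normr0 // => k _; rewrite mul0r.
Qed.

Lemma analytic_mulX f z : analytic_at f z -> analytic_at (fun w => (w - z) * f w) z.
Proof.
move=> /analytic_atP[a ha].
apply/analytic_atP; exists (fun k => if k is k'.+1 then a k' else 0).
apply: filterS ha => w aw; apply/cvgCP => e e0.
have d0 : 0 < e / (`|w - z| + 1) by rewrite divr_gt0 // ltr_wpDl.
have /cvgCP/(_ _ d0)[N hN] := aw; exists N.+1 => -[//|n]; rewrite ltnS => Nn.
rewrite /psum big_ord_recl mul0r add0r.
have -> : \sum_(i < n) a i * (w - z) ^+ (bump 0 i) = (w - z) * psum a (w - z) n.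
  by rewrite /psum mulr_sumr; apply: eq_bigr => i _; rewrite exprS; ring.
rewrite -mulrBr normrM (@le_lt_trans _ _ (`|w - z| * (e / (`|w - z| + 1)))) //.
  by rewrite ler_wpM2l // ltW // hN.
rewrite mulrA ltr_pdivrMr ?ltr_wpDl // mulrC ltr_pM2l // ltrDl ltr01 //.
Qed.

Lemma analytic_mulXn f z m : analytic_at f z -> analytic_at (fun w => (w - z) ^+ m * f w) z.
Proof.
move=> fz; elim: m => [|m IH].
  by under eq_fun do rewrite expr0 mul1r.
by under eq_fun do rewrite exprS -mulrA; exact: analytic_mulX.
Qed.

Lemma analytic_scale c f z : analytic_at f z -> analytic_at (fun w => c * f w) z.
Proof.
move=> /analytic_atP[a ha]; apply/analytic_atP; exists (fun k => c * a k).
apply: filterS ha => w aw; apply/cvgCP => e e0.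
have d0 : 0 < e / (`|c| + 1) by rewrite divr_gt0 // ltr_wpDl.
have /cvgCP/(_ _ d0)[N hN] := aw; exists N => n Nn.
have -> : psum (fun k => c * a k) (w - z) n = c * psum a (w - z) n.
  by rewrite /psum mulr_sumr; apply: eq_bigr => i _; rewrite mulrA.
rewrite -mulrBr normrM (@le_lt_trans _ _ (`|c| * (e / (`|c| + 1)))) //.
  by rewrite ler_wpM2l // ltW // hN.
rewrite mulrA ltr_pdivrMr ?ltr_wpDl // mulrC ltr_pM2l // ltrDl ltr01 //.
Qed.

Lemma analytic_add f h z : analytic_at f z -> analytic_at h z ->
  analytic_at (fun w => f w + h w) z.
Proof.
move=> fz hz; have -> : (fun w => f w + h w) = (fun w => f w - (-1) * h w).
  by apply/funext => w; ring.
exact: (analytic_sub fz (analytic_scale (-1) hz)).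
Qed.

Lemma analytic_horner (p : {poly C}) z : analytic_at (fun w => p.[w]) z.
Proof.
elim/poly_ind: p => [|p c IH].
  by under eq_fun do rewrite horner0; exact: analytic_cst.
have -> : (fun w => (p * 'X + c%:P).[w]) = (fun w => (w - z) * p.[w] + (z * p.[w] + c)).
  by apply/funext => w; rewrite hornerMXaddC; ring.
exact: (analytic_add (analytic_mulX IH) (analytic_add (analytic_scale z IH) (analytic_cst c z))).
Qed.

(* With a_m the first nonzero coefficient, f(w) - a_m (w - z)^m is
   O((w - z)^(m+1)). *)
Lemma analytic_isolated f z : analytic_at f z ->
  (\forall w \near z^', f w != 0) \/ (\forall w \near z, f w = 0).
Proof.
move=> /analytic_atP[a fa].
have uniq (u : nat -> C) (l l' : C) : u @ \oo --> l -> u @ \oo --> l' -> l = l'.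
  exact: (@cvg_unique _ (@norm_hausdorff _ _)).
have [[m [am amin]]|/forallNP a0] := pselect (exists m, a m != 0 /\ forall k, (k < m)%N -> a k = 0); last first.
  right; have {}a0 k : a k = 0.
    elim/ltn_ind: k => k IH; apply/eqP; apply/negPn/negP => ak.
    by apply: (a0 k); split.
  apply: filterS fa => w fw; apply: (uniq _ _ _ fw).
  apply/cvgCP => e e0; exists 0%N => n _; rewrite /psum big1 ?subrr ?normr0 //.
  by move=> k _; rewrite a0 mul0r.
left; have [r [B [r0 B0 hB]]] := analytic_bound fa.
have am0 : 0 < `|a m| by rewrite normr_gt0.
have /nearCP[e e0 he] := fa.
pose s : C := r^-1; have s0 : 0 < s by rewrite invr_gt0.
(* The factor 2 bounds the geometric series of ratio 1/2 that [H1] provides. *)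
pose K : C := B * s ^+ m.+1 * 2.
have K0 : 0 < K by rewrite !mulr_gt0 ?exprn_gt0.
have H1 : \forall w \near z^', `|w - z| * s <= 2^-1.
  apply/dnearCP; exists (2^-1 / s); first by rewrite divr_gt0.
  by move=> w; rewrite distrC ltr_pdivlMr // => /ltW.
have H2 : \forall w \near z^', K * `|w - z| < `|a m|.
  apply/dnearCP; exists (`|a m| / K); first by rewrite divr_gt0.
  by move=> w; rewrite distrC ltr_pdivlMr // mulrC.
have H3 : \forall w \near z^', w != z by apply/dnearCP; exists 1.
have H4 : \forall w \near z^', psum a (w - z) @ \oo --> f w by exact: near_dnear.
apply: filterS2 (filterI H1 H2) (filterI H3 H4) => w [xs Kx] [wz cv]; apply/eqP => fw0.
rewrite fw0 in cv; move: xs Kx cv.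
set x := w - z => xs Kx cv; have x0 : x != 0 by rewrite subr_eq0.
have nx0 : 0 < `|x| by rewrite normr_gt0.
have est n : `|psum a x (m.+1 + n) - a m * x ^+ m| <= K * `|x| ^+ m.+1.
  rewrite /psum big_split_ord /= big_ord_recr /= big1 ?add0r => [|k _]; last first.
    by rewrite amin ?mul0r.
  rewrite addrAC subrr add0r (le_trans (ler_norm_sum _ _ _)) //.
  apply: (@le_trans _ _ (\sum_(i < n) B * s ^+ m.+1 * `|x| ^+ m.+1 * 2^-1 ^+ i)).
    apply: ler_sum => i _; rewrite normrM normrX.
    apply: (@le_trans _ _ (B * s ^+ (m.+1 + i) * `|x| ^+ (m.+1 + i))).
      by rewrite ler_wpM2r ?exprn_ge0.
    rewrite !exprD.
    have -> : B * (s ^+ m.+1 * s ^+ i) * (`|x| ^+ m.+1 * `|x| ^+ i)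
      = B * s ^+ m.+1 * `|x| ^+ m.+1 * (`|x| * s) ^+ i by rewrite exprMn; ring.
    rewrite ler_wpM2l ?mulr_ge0 ?exprn_ge0 ?(ltW B0) ?(ltW s0) //.
    by rewrite lerXn2r ?nnegrE ?mulr_ge0 ?(ltW s0) ?invr_ge0.
  rewrite -mulr_sumr /K -[B * _ * 2 * _]mulrA [2 * _]mulrC mulrA ler_wpM2l //.
    by rewrite !mulr_ge0 ?exprn_ge0 ?(ltW B0) ?(ltW s0).
  suff -> : \sum_(i < n) (2^-1 : C) ^+ i = 2 - 2 * 2^-1 ^+ n.
    by rewrite gerBl mulr_ge0 // exprn_ge0 // invr_ge0.
  elim: (n) => [|j IH]; first by rewrite big_ord0 expr0 mulr1 subrr.
  by rewrite big_ord_recr /= IH exprS; field.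
have : `|a m * x ^+ m| <= K * `|x| ^+ m.+1.
  apply/ler_addgt0Pr => d d0; have /cvgCP/(_ d d0)[N hN] := cv.
  have := hN (m.+1 + N)%N (leq_addl _ _); rewrite sub0r normrN => hd.
  have -> : a m * x ^+ m = psum a x (m.+1 + N) - (psum a x (m.+1 + N) - a m * x ^+ m).
    by rewrite opprB addrC subrK.
  rewrite (le_trans (ler_normB _ _)) // addrC lerD ?est // ltW //.
rewrite normrM normrX exprS mulrA ler_pM2r ?exprn_gt0 // => h.
by have := lt_le_trans Kx h; rewrite ltxx.
Qed.

End Analytic.

Section Meromorphic.
Context {R : realType}.
Local Notation C := R[i]^o.
Implicit Types (z w e : C) (f h : C -> C) (a b : nat -> C).

(** With the divisor normalized to 1 - rho (w - z), the coefficients of the quotient satisfy b_k =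
    a_k + rho b_(k-1); the geometric bound on a passes to b with twice the ratio. *)
Lemma analytic_div_linear f z (c d : C) : c + d * z != 0 -> analytic_at f z ->
  analytic_at (fun w => f w / (c + d * w)) z.
Proof.
set k0 := c + d * z => k00 /analytic_atP[a fa].
suff h : analytic_at (fun w => f w / (1 - (- d / k0) * (w - z))) z.
  have -> : (fun w => f w / (c + d * w))
     = (fun w => k0^-1 * (f w / (1 - (- d / k0) * (w - z)))).
    apply/funext => w; have -> : c + d * w = k0 * (1 - (- d / k0) * (w - z)).
      by rewrite /k0 in k00 *; field.
    by rewrite invfM; ring.
  exact: analytic_scale.
have [r [B [r0 B0 hB]]] := analytic_bound fa.
move: (- d / k0) => rho {k00 k0 c d}.
pose s : C := r^-1 + `|rho|; have s0 : 0 < s by rewrite ltr_pwDl ?invr_gt0.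
pose b := fix b k : C := if k is k'.+1 then a k + rho * b k' else a k.
have as_ k : `|a k| <= B * s ^+ k.
  rewrite (le_trans (hB k)) // ler_wpM2l ?(ltW B0) // lerXn2r ?nnegrE ?(ltW s0) ?invr_ge0 ?(ltW r0) //.
  by rewrite lerDl.
have bs k : `|b k| <= B * (2 * s) ^+ k.
  elim: k => [|k IH]; first exact: (le_trans (as_ 0%N)).
  rewrite /= (le_trans (ler_normD _ _)) // normrM.
  apply: (@le_trans _ _ (B * s ^+ k.+1 + s * (B * (2 * s) ^+ k))).
    by rewrite lerD ?as_ // ler_pM // /s lerDr invr_ge0 ltW.
  have -> : B * s ^+ k.+1 + s * (B * (2 * s) ^+ k) = B * s ^+ k.+1 * (1 + 2 ^+ k).
    by rewrite exprMn exprS; ring.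
  rewrite exprMn [2 ^+ k.+1 * _]mulrC mulrA ler_wpM2l ?mulr_ge0 ?exprn_ge0 ?(ltW B0) ?(ltW s0) //.
  have -> : 2 ^+ k.+1 = 2 ^+ k + 2 ^+ k :> C by rewrite exprS; ring.
  by rewrite lerD2r exprn_ege1 // ler1n.
apply/analytic_atP; exists b.
(* This makes 2 s |w - z| less than 1/2, so b_n (w - z)^n is at most B / 2^n. *)
have H1 : \forall w \near z, `|w - z| * (4 * s) < 1.
  apply/nearCP; exists (4 * s)^-1; first by rewrite invr_gt0 mulr_gt0.
  by move=> w; rewrite distrC -ltr_pdivlMr ?mulr_gt0 // div1r.
apply: filterS2 fa H1 => w; set x := w - z => cva xs.
have rhox : 0 < `|1 - rho * x|.
  rewrite normr_gt0 subr_eq0; apply: contraTneq xs => E.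
  have : (1 : C) <= `|x| * (4 * s); last by move=> h1; apply/negP => /(le_lt_trans h1); rewrite ltxx.
    rewrite [leLHS](_ : 1 = `|rho| * `|x|); last by rewrite -normrM -E normr1.
    rewrite mulrC ler_wpM2l // (@le_trans _ _ s) //.
      by rewrite /s lerDr invr_ge0 ltW.
    by apply: ler_peMl; [exact: ltW|rewrite ler1n].
have bx : (fun n => b n * x ^+ n) @ \oo --> (0 : C).
  have h2 : `|2^-1 : C| < 1 by rewrite ger0_norm ?invr_ge0 // invf_lt1 // ltr1n.
  apply/cvgCP => e e0; have /cvgCP/(_ (e / B)) := expC_cvg0 h2.
  case=> [|N hN]; first by rewrite divr_gt0.
  exists N => n Nn; have := hN n Nn; rewrite !sub0r !normrN => h3.
  apply: (@le_lt_trans _ _ (B * 2^-1 ^+ n)); last first.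
    move: h3; rewrite ger0_norm ?exprn_ge0 ?invr_ge0 // ltr_pdivlMr // mulrC //.
  rewrite normrM normrX (@le_trans _ _ (B * (2 * s) ^+ n * `|x| ^+ n)) //.
    by rewrite ler_wpM2r ?exprn_ge0.
  rewrite -mulrA -exprMn ler_wpM2l ?(ltW B0) // lerXn2r ?nnegrE ?invr_ge0 //.
    by rewrite !mulr_ge0 ?(ltW s0).
  rewrite -[2^-1]mul1r ler_pdivlMr //; move/ltW: xs; congr (_ <= _); ring.
(* The recurrence telescopes up to one boundary term, which tends to 0 by [bx]. *)
have rec n : (1 - rho * x) * psum b x n.+1 = psum a x n.+1 - rho * x * (b n * x ^+ n).
  elim: n => [|n IH]; first by rewrite /psum !big_ord_recr !big_ord0 /=; ring.
  rewrite {1}/psum big_ord_recr -/(psum b x n.+1) mulrDr IH.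
  rewrite [psum a x n.+2]/psum big_ord_recr -/(psum a x n.+1) /= exprS; ring.
apply/cvgCP => e e0.
have d0 : 0 < `|1 - rho * x| * e / 2 by rewrite divr_gt0 // mulr_gt0.
have d1 : 0 < `|1 - rho * x| * e / 2 / (`|rho * x| + 1) by rewrite divr_gt0 // ltr_wpDl.
have /cvgCP/(_ _ d0)[N hN] := cva; have /cvgCP/(_ _ d1)[M hM] := bx.
exists (maxn N M).+1 => -[//|n]; rewrite ltnS geq_max => /andP[Nn Mn].
rewrite -(ltr_pM2l rhox) -normrM mulrBr rec mulrCA divff -?normr_gt0 // mulr1.
have -> : f w - (psum a x n.+1 - rho * x * (b n * x ^+ n))
  = (f w - psum a x n.+1) + rho * x * (b n * x ^+ n) by ring.
rewrite (le_lt_trans (ler_normD _ _)) // [_ * e]splitr ltr_leD ?hN ?(leqW Nn) //.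
have := hM n Mn; rewrite sub0r normrN ltr_pdivlMr ?ltr_wpDl // => /ltW.
apply: le_trans; rewrite normrM mulrC ler_wpM2l // lerDl ler01 //.
Qed.

Lemma analytic_div_linearX f z (c d : C) m : c + d * z != 0 -> analytic_at f z ->
  analytic_at (fun w => f w / (c + d * w) ^+ m) z.
Proof.
move=> k0 fz; elim: m => [|m IH].
  by under eq_fun do rewrite expr0 divr1.
have -> : (fun w => f w / (c + d * w) ^+ m.+1) = (fun w => f w / (c + d * w) ^+ m / (c + d * w)).
  by apply/funext => w; rewrite exprSr invfM; ring.
exact: (analytic_div_linear k0 IH).
Qed.

(** Removable singularities have to be filled in, hence the induction on m: a factor of p that
    vanishes at 1 / q is cancelled first, and otherwise the pole is genuine. *)
Lemma rational_meromorphic (q : C) m (p : {poly C}) : q != 0 ->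
  exists h, meromorphic h /\ forall w, 1 - q * w != 0 -> h w = p.[w] / (1 - q * w) ^+ m.
Proof.
move=> q0; elim: m p => [|m IH] p.
  exists (fun w => p.[w]); split=> [z|w _]; last by rewrite expr0 divr1.
  by left; exact: analytic_horner.
have [rp|rp] := boolP (root p q^-1).
  have /factor_theorem[p' Dp] := rp; have [h [hm hE]] := IH ((- q^-1) *: p').
  exists h; split=> // w w1; rewrite hE // Dp hornerM hornerZ hornerXsubC exprS.
  by field; rewrite w1 q0 expf_neq0.
exists (fun w => p.[w] / (1 - q * w) ^+ m.+1); split=> // z.
have [Dz|z1] := eqVneq (1 - q * z) 0; last first.
  left; have -> : (fun w => p.[w] / (1 - q * w) ^+ m.+1) = (fun w => p.[w] / (1 + (- q) * w) ^+ m.+1).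
    by apply/funext => w; rewrite mulNr.
  by apply: analytic_div_linearX; [rewrite mulNr|exact: analytic_horner].
(* The convention that 0 is its own inverse supplies the value 0 required at a pole. *)
right; rewrite Dz expr0n /= invr0 mulr0; split=> //.
have Ez : z = q^-1.
  by apply: (mulfI q0); move/eqP: Dz; rewrite subr_eq0 divff // => /eqP <-.
exists m.+1, (fun w => (((- q)^-1) ^+ m.+1 *: p).[w]); split=> //.
- exact: analytic_horner.
- by rewrite hornerZ mulf_neq0 // ?expf_neq0 ?invr_eq0 ?oppr_eq0 // Ez.
- apply/dnearCP; exists 1 => // w _ wz; rewrite hornerZ.
  have -> : 1 - q * w = (- q) * (w - z).
    by rewrite Ez; field.
  by rewrite exprMn invfM exprVn mulrA [p.[w] * _]mulrC.
Qed.

End Meromorphic.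

(** * The identity theorem for meromorphic functions *)

Section Identity.
Context {R : realType}.
Local Notation C := R[i]^o.
Implicit Types (z w e : C) (f h : C -> C) (a b : nat -> C).

Lemma meromorphic_at_analytic h z : meromorphic_at h z ->
  exists m f, analytic_at f z /\ \forall w \near z^', h w * (w - z) ^+ m = f w.
Proof.
case=> [hz|[_ [m [f [_ fz _ hf]]]]].
  exists 0%N, h; split=> //; apply/dnearCP; exists 1 => // w _ _; exact: mulr1.
exists m, f; split=> //.
have H : \forall w \near z^', w != z by apply/dnearCP; exists 1.
apply: filterS2 hf H => w -> wz.
by rewrite divfK // expf_neq0 // subr_eq0.
Qed.

(** Clearing both denominators makes the difference analytic, and its zeros are isolated or fill a
    neighbourhood. *)
Lemma meromorphic_dichotomy h1 h2 z : meromorphic_at h1 z -> meromorphic_at h2 z ->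
  (\forall w \near z^', h1 w = h2 w) \/ (\forall w \near z^', h1 w != h2 w).
Proof.
move=> /meromorphic_at_analytic[m1 [f1 [a1 E1]]] /meromorphic_at_analytic[m2 [f2 [a2 E2]]].
have aD := analytic_sub (analytic_mulXn m2 a1) (analytic_mulXn m1 a2).
have H : \forall w \near z^', w != z by apply/dnearCP; exists 1.
have E : \forall w \near z^', (h1 w - h2 w) * (w - z) ^+ (m1 + m2)
    = (w - z) ^+ m2 * f1 w - (w - z) ^+ m1 * f2 w.
  by apply: filterS2 E1 E2 => w <- <-; rewrite exprD; ring.
case: (analytic_isolated aD) => D; [right|left; move: D => /near_dnear D].
  apply: filterS2 E D => w <-; apply: contraNneq => ->.
  by rewrite subrr mul0r.
apply: filterS3 E D H => w E0 D0 wz; move: D0; rewrite -E0 => /eqP.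
by rewrite mulf_eq0 expf_eq0 subr_eq0 subr_eq0 (negPf wz) andbF orbF => /eqP.
Qed.

Lemma dnear_open z (P : C -> Prop) : (\forall w \near z^', P w) ->
  exists2 e, 0 < e & forall w, `|z - w| < e -> \forall v \near w^', P v.
Proof.
move=> /dnearCP[e e0 h]; exists (e / 2) => [|w zw]; first by rewrite divr_gt0.
have e2 : 0 < e / 2 by rewrite divr_gt0.
have [->|wz] := eqVneq w z; first by apply/dnearCP; exists e.
have dw : 0 < `|z - w| by rewrite normr_gt0 subr_eq0 eq_sym.
apply/dnearCP; exists `|z - w| => // v wv vw; apply: h.
  have -> : z - v = (z - w) + (w - v) by rewrite addrA subrK.
  by rewrite (le_lt_trans (ler_normD _ _)) // [e]splitr ltrD // (lt_trans wv).
by apply: contraTneq wv => ->; rewrite distrC ltxx.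
Qed.

Lemma dnear_open_segment z (P : C -> Prop) :
  open [set t : R | \forall w \near ((t%:C)%C * z : C)^', P w].
Proof.
rewrite openE => t /= /dnear_open[e /posC_real[d d0 ->] h].
have [r r0 Dr] := normC_real z.
have r1 : 0 < r + 1 by rewrite ltr_wpDl.
apply/nbhs_normP; exists (d / (r + 1)) => [|s /= ts]; first by rewrite /= divr_gt0.
apply: h; rewrite -mulrBl -rmorphB normrM Dr.
have -> : `|(t - s)%:C%C : C| = (`|t - s|%:C)%C.
  by rewrite normc_def /= expr0n addr0 sqrtr_sqr.
rewrite -rmorphM ltcR; apply: (@le_lt_trans _ _ (`|t - s| * (r + 1))).
  by rewrite ler_wpM2l // lerDl.
by rewrite -ltr_pdivlMr.
Qed.

(* Where two meromorphic functions agree and where they differ on a punctured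
   neighbourhood are open conditions, so connectedness of the segment [0, z] decides. *)
Lemma meromorphic_germ_eq h1 h2 z : meromorphic h1 -> meromorphic h2 ->
  (\forall w \near (0 : C)^', h1 w = h2 w) -> \forall w \near z^', h1 w = h2 w.
Proof.
move=> m1 m2 h0.
pose P t := \forall w \near ((t%:C)%C * z : C)^', h1 w = h2 w.
have [oP oN] : open [set t : R | P t] /\
    open [set t : R | \forall w \near ((t%:C)%C * z : C)^', h1 w != h2 w].
  by split; exact: dnear_open_segment.
have cP : closed [set t : R | P t].
  rewrite -openC; move: oN; congr open; apply/seteqP; split=> t /= ht.
    move=> Pt; have [w _ [/eqP]] := proper_dnear (filterI ht Pt); exact.
  by case: (meromorphic_dichotomy (m1 ((t%:C)%C * z)) (m2 ((t%:C)%C * z))).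
have seg : `[0, 1] `&` [set t : R | P t] = `[0, 1]%classic.
  apply: segment_connected.
  - exists 0; split; first by rewrite /= in_itv /= lexx ler01.
    by rewrite /= /P rmorph0 mul0r.
  - by exists [set t : R | P t].
  - by exists [set t : R | P t].
have : P 1; last by rewrite /P rmorph1 mul1r.
have : (`[0, 1]%classic : set R) 1 by rewrite /= in_itv /= lexx ler01.
by rewrite -seg => -[].
Qed.

Lemma dnear_analytic_eq f h z : analytic_at f z -> analytic_at h z ->
  (\forall w \near z^', f w = h w) -> f z = h z.
Proof.
move=> af ah fh; case: (analytic_isolated (analytic_sub af ah)) => D.
  have [w _ [-> /eqP]] := proper_dnear (filterI fh D); by rewrite subrr.
by apply/eqP; rewrite -subr_eq0; apply/eqP; move: D => /nbhs_singleton.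
Qed.

(** The normalization turns equality near z into equality at z: analytic values are determined by
    nearby ones, two poles both have value 0, and [mixed] excludes a pole against an analytic
    point. *)
Lemma meromorphic_eq h1 h2 : meromorphic h1 -> meromorphic h2 ->
  (\forall w \near (0 : C), h1 w = h2 w) -> h1 = h2.
Proof.
move=> m1 m2 h0; apply/funext => z.
have E := meromorphic_germ_eq z m1 m2 (near_dnear h0).
have H : \forall w \near z^', w != z by apply/dnearCP; exists 1.
have mixed f h : analytic_at f z ->
    h z = 0 /\ (exists (m : nat) (g : C -> C),
     [/\ (0 < m)%N, analytic_at g z, g z != 0 & \forall w \near z^', h w = g w / (w - z) ^+ m]) ->
    (\forall w \near z^', f w = h w) -> False.
  move=> af [_ [m [g [m0 ag gz hE]]]] fh.
  have : (z - z) ^+ m * f z = g z.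
    apply: (dnear_analytic_eq (analytic_mulXn m af) ag).
    apply: filterS3 fh hE H => w -> -> wz.
    by rewrite mulrC divfK // expf_neq0 // subr_eq0.
  by rewrite subrr expr0n gtn_eqF // mul0r => /esym/eqP; rewrite (negPf gz).
case: (m1 z) => [a1|p1]; case: (m2 z) => [a2|p2].
- exact: dnear_analytic_eq.
- by have := mixed _ _ a1 p2 E.
- by exfalso; apply: (mixed _ _ a2 p1); apply: filterS E.
- by rewrite p1.1 p2.1.
Qed.

End Identity.

(** * Unordered sums over monic polynomials *)

Section MonicSums.
Context {F : finFieldType}.

Lemma monicXnD n (a : {poly_n F}) : 'X^n + polyn a \is monic.
Proof.
apply/monicP; rewrite lead_coefDl ?lead_coefXn //.
by rewrite size_polyXn ltnS size_npoly.
Qed.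

Lemma size_XnD n (a : {poly_n F}) : size ('X^n + polyn a) = n.+1.
Proof. by rewrite size_polyDl size_polyXn // ltnS size_npoly. Qed.

Local Notation monic_poly := {f : {poly F} | f \is monic}.

Definition XnD n (a : {poly_n F}) : monic_poly := exist (fun f => f \is monic) _ (monicXnD a).

Lemma XnD_inj n : injective (@XnD n).
Proof. by move=> a b [/addrI E]; apply: val_inj. Qed.

Lemma XnD_surj (f : monic_poly) n : size (val f) = n.+1 -> exists a, f = @XnD n a.
Proof.
case: f => f fm /= sf.
have [a Da] : exists a : {poly_n F}, f - 'X^n = a.
  apply: npoly_ex; apply/leq_sizeP => j; rewrite leq_eqVlt => /orP[/eqP <-|nj].
    by rewrite coefB coefXn eqxx -[X in f`_X]/(n.+1.-1) -sf -lead_coefE (monicP fm) subrr.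
  by rewrite coefB coefXn nth_default ?sf // gtn_eqF // subr0.
by exists a; apply: val_inj; rewrite /= -Da addrC subrK.
Qed.

Lemma monic_fset_sum (V : nmodType) (K : {fset monic_poly}) (T : monic_poly -> V) n :
  \sum_(f <- K | size (val f) == n.+1) T f
  = \sum_(a : {poly_n F} | XnD a \in K) T (XnD a).
Proof.
rewrite -big_filter -(big_map (@XnD n) (fun f => f \in K) T) -[RHS]big_filter.
apply/perm_big/uniq_perm; first exact/filter_uniq/fset_uniq.
  by apply: filter_uniq; rewrite map_inj_uniq ?index_enum_uniq //; exact: XnD_inj.
move=> f; rewrite !mem_filter andbC; case fK: (f \in K) => //=.
apply/eqP/mapP => [/XnD_surj[a ->]|[a _ ->]]; first by exists a; rewrite ?mem_index_enum.
exact: size_XnD.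
Qed.

Context {R : realType}.
Local Notation C := R[i]^o.

(** A finite set containing all monic polynomials of degree below M differs from the degree-ordered
    partial sum only in degrees at least M, where the tail of the majorant [beta] controls it. *)
Lemma unordered_cvg (T : monic_poly -> C) (l : C) (beta : nat -> C) :
  (forall n, \sum_(a : {poly_n F}) `|T (XnD a)| <= beta n) ->
  (forall e, 0 < e -> exists M0, forall M M', (M0 <= M)%N -> \sum_(M <= n < M') beta n < e) ->
  (fun M => \sum_(n < M) \sum_(a : {poly_n F}) T (XnD a)) @ \oo --> l ->
  partial_sum T @ totally --> l.
Proof.
move=> hb tail /cvgCP cv.
have tot_filter : ProperFilter (@totally monic_poly) := totally_filter.
apply/cvgrPdist_lt => e e0.
have e2 : 0 < e / 2 by rewrite divr_gt0.
have [M0 hM0] := tail _ e2; have [N0 hN0] := cv _ e2.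
pose M := maxn M0 N0.
pose A := [fset x in flatten [seq [seq @XnD n a | a : {poly_n F}] | n <- iota 0 M]]%fset.
have AXnD n (a : {poly_n F}) : (n < M)%N -> XnD a \in A.
  move=> nM; rewrite in_fset; apply/flattenP.
  exists [seq @XnD n a | a : {poly_n F}]; last by rewrite mem_map ?mem_enum //; exact: XnD_inj.
  by apply/mapP; exists n; rewrite ?mem_iota.
exists A => // K AK.
(* Larger than every degree in [K], so [K] splits into degrees below [M']. *)
pose M' := (M + \max_(f <- K) size (val f))%N.
have MM' : (M <= M')%N by rewrite leq_addr.
have KE : partial_sum T K = \sum_(0 <= n < M') \sum_(a : {poly_n F} | XnD a \in K) T (XnD a).
  rewrite /partial_sum -(big_seq_fsetE _ _ predT T) /=.
  under [RHS]eq_bigr => n _ do rewrite -monic_fset_sum.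
  transitivity (\sum_(f <- K) \sum_(0 <= n < M' | size (val f) == n.+1) T f); last first.
    under [LHS]eq_bigr => f _ do rewrite big_mkcond.
    rewrite exchange_big /=; apply: eq_bigr => n _; by rewrite [RHS]big_mkcond.
  rewrite big_seq [RHS]big_seq; apply: eq_bigr => f fK.
  have s0 : (0 < size (val f))%N by rewrite size_poly_gt0 monic_neq0 // (valP f).
  have sM : ((size (val f)).-1 < M')%N.
    rewrite prednK // (leq_trans _ (leq_addl _ _)) //.
    exact: (leq_bigmax_seq f fK).
  rewrite big_mkord (bigD1 (Ordinal sM)) /= ?prednK // big1 ?addr0 // => j /andP[/eqP sj].
  by case/negP; apply/eqP/val_inj; rewrite /= sj.
rewrite KE (big_cat_nat (leq0n M) MM') /= opprD addrA.
rewrite (le_lt_trans (ler_normB _ _)) // [e]splitr ltrD //.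
  rewrite big_mkord; apply: le_lt_trans (hN0 M (leq_maxr _ _)).
  rewrite le_eqVlt; apply/orP; left; apply/eqP; congr `|_ - _|.
  apply: eq_bigr => n _; apply: eq_bigl => a.
  by apply: (fsubsetP AK); apply: AXnD.
apply: le_lt_trans (hM0 M M' (leq_maxl _ _)).
rewrite (le_trans (ler_norm_sum _ _ _)) // ler_sum // => n _.
apply: le_trans (hb n); rewrite (le_trans (ler_norm_sum _ _ _)) //.
rewrite [leRHS](bigID (fun a => XnD a \in K)) /= lerDl sumr_ge0 //.
Qed.

(* y^(n+1) - x^(n+1) >= (y - x) (n+1) x^n for x < y < 1. *)
Lemma linear_geometric_bound (x : C) : 0 <= x -> x < 1 ->
  exists y D : C, [/\ 0 <= y, y < 1, 0 < D & forall n, n.+1%:R * x ^+ n <= D * y ^+ n].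
Proof.
move=> x0 x1; pose y := (1 + x) / 2.
have y0 : 0 <= y by rewrite divr_ge0 // addr_ge0.
have y1 : y < 1 by rewrite ltr_pdivrMr // mul1r -[2]/(1 + 1) ltrD2l.
have xy : x < y by rewrite ltr_pdivlMr // mulr_natr mulr2n ltrD2r.
have d0 : 0 < y - x by rewrite subr_gt0.
exists y, (y - x)^-1; split=> //; first by rewrite invr_gt0.
move=> n; rewrite [leRHS]mulrC ler_pdivlMr // (@le_trans _ _ (y ^+ n.+1)) //; last first.
  by rewrite exprS ler_piMl ?exprn_ge0 // ltW.
apply: (@le_trans _ _ (y ^+ n.+1 - x ^+ n.+1)); last by rewrite gerBl exprn_ge0.
rewrite subrXX mulrC ler_wpM2l ?(ltW d0) //.
rewrite mulr_natl -[n.+1 in leLHS]card_ord -sumr_const ler_sum // => i _.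
have in_ : (i <= n)%N by rewrite -ltnS.
rewrite /= -[X in x ^+ X](subnK in_) exprD ler_wpM2r ?exprn_ge0 //.
by rewrite lerXn2r ?nnegrE ?(ltW xy).
Qed.

End MonicSums.

(** * Double series summed along the diagonals i + j = N *)

Section TriangularSums.
Context {K : numFieldType}.
Implicit Types (f : nat -> nat -> K).

Lemma triangle_sum f M : \sum_(N < M) \sum_(i < N.+1) f i (N - i)%N
  = \sum_(i < M) \sum_(j < M - i) f i j.
Proof.
elim: M => [|M IH]; first by rewrite !big_ord0.
rewrite big_ord_recr /= IH !big_ord_recr /= addrA -big_split /=; congr (_ + _).
  apply: eq_bigr => i _; rewrite subSn ?big_ord_recr //; exact: ltnW.
by rewrite subSnn subnn big_ord_recl big_ord0 addr0.
Qed.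

Lemma shifted_sum (G : nat -> K) n t :
  \sum_(j < t) (if (n <= j)%N then G (j - n)%N else 0) = \sum_(j < t - n) G j.
Proof.
have [tn|/ltnW nt] := leqP t n.
  have -> : (t - n = 0)%N by apply/eqP; rewrite subn_eq0.
  rewrite big_ord0 big1 // => j _.
  by rewrite leqNgt (leq_trans (ltn_ord j) tn).
have {nt} -> : t = (n + (t - n))%N by rewrite subnKC.
rewrite addKn big_split_ord /= big1 ?add0r => [|j _].
  by apply: eq_bigr => j _; rewrite leq_addr addKn.
by rewrite leqNgt ltn_ord.
Qed.

Lemma geometric_sum (x : K) n : 1 - x != 0 -> \sum_(j < n) x ^+ j = (1 - x ^+ n) / (1 - x).
Proof.
move=> x1; elim: n => [|n IH]; first by rewrite big_ord0 expr0 subrr mul0r.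
by rewrite big_ord_recr /= IH exprS; field.
Qed.

Variables (c : nat -> nat -> K) (s : nat -> K) (q cg d u : K) (n k N0 : nat).
Hypothesis c_low : forall i j, (N0 <= i)%N -> (j < n)%N -> c i j = 0.
Hypothesis c_high : forall i j, (n <= j)%N ->
  c i j = if (n <= i)%N then q ^+ j * cg * s (i - n)%N else 0.
Hypothesis s_high : forall i, (k <= i)%N -> s i = d * q ^+ i.
Hypothesis dk : d != 0 -> k = 0%N.
Hypothesis s_norm : forall i, `|s i| <= `|q| ^+ i.
Hypothesis qu1 : `|q * u| < 1.
Local Notation x := (q * u).

Let x1 : 1 - x != 0.
Proof.
rewrite subr_eq0; apply: contraTneq qu1 => <-; rewrite normr1 ltxx //.
Qed.

(** This is [R2_rat] when [c], [s], [cg] and [d] are [twisted_sum], [monic_sum], chi g and the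
    indicator of k = 0. *)
Definition estermann_limit : K :=
  \sum_(i < N0) \sum_(j < n) c i j * u ^+ (i + j)
  + cg * (q * u ^+ 2) ^+ n * (\sum_(a < k) s a * u ^+ a + d / (1 - x)) / (1 - x).

(** For such M the terms with j < n are all included. The block i, j >= n is a product of two series
    cut along a diagonal; the cut replaces full geometric series by partial ones, and the error is
    at most a constant plus m, times |x|^m, with m = M - 2 n because both indices are shifted by
    n. *)
Lemma triangle_limit_error M : (N0 + n + n + k <= M)%N ->
  `|\sum_(N < M) \sum_(i < N.+1) c i (N - i)%N * u ^+ N - estermann_limit|
  <= `|cg * (q * u ^+ 2) ^+ n / (1 - x)| * (`|d / (1 - x)| + 1)
     * ((M - n - n).+1%:R * `|x| ^+ (M - n - n)).
Proof.
move=> NM; set m := (M - n - n)%N.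
have -> : \sum_(N < M) \sum_(i < N.+1) c i (N - i)%N * u ^+ N
  = \sum_(i < M) \sum_(j < M - i) c i j * u ^+ (i + j).
  rewrite -(triangle_sum (fun i j => c i j * u ^+ (i + j))).
  by apply: eq_bigr => N _; apply: eq_bigr => i _; rewrite subnKC // -ltnS.
have c_shift i j : (n <= i)%N -> (n <= j)%N -> c i j * u ^+ (i + j)
    = cg * (q * u ^+ 2) ^+ n * (s (i - n)%N * u ^+ (i - n)) * x ^+ (j - n).
  move=> ni nj; rewrite (c_high _ nj) ni.
  move: ni nj => /subnKC <- /subnKC <-; rewrite !addKn.
  by rewrite expr2 !exprD !exprMn; ring.
pose G i j := cg * (q * u ^+ 2) ^+ n * (s i * u ^+ i) * x ^+ j.
pose H i := \sum_(j < M - n - i) (if (n <= j)%N then G i (j - n)%N else 0).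
have -> : \sum_(i < M) \sum_(j < M - i) c i j * u ^+ (i + j)
  = \sum_(i < M) \sum_(j < M - i) (if (j < n)%N then c i j * u ^+ (i + j) else 0)
  + \sum_(i < M) (if (n <= i)%N then H (i - n)%N else 0).
  rewrite /H -big_split; apply: eq_bigr => i _ /=; case: leqP => ni.
    have -> : (M - n - (i - n) = M - i)%N by lia.
    rewrite -big_split; apply: eq_bigr => j _ /=; case: leqP => nj; last by rewrite addr0.
    by rewrite add0r c_shift.
  rewrite addr0; apply: eq_bigr => j _; case: leqP => nj //.
  by rewrite (c_high _ nj) leqNgt ni mul0r.
have -> : \sum_(i < M) \sum_(j < M - i) (if (j < n)%N then c i j * u ^+ (i + j) else 0)
    = \sum_(i < N0) \sum_(j < n) c i j * u ^+ (i + j).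
  have -> : M = (N0 + (M - N0))%N by lia.
  rewrite big_split_ord /= [X in _ + X]big1 ?addr0 => [|i _]; last first.
    by apply: big1 => j _; case: ltnP => // jn; rewrite c_low ?mul0r ?leq_addr.
  apply: eq_bigr => i _; have iN := ltn_ord i.
  have -> : (N0 + (M - N0) - i = n + (M - i - n))%N by lia.
  rewrite big_split_ord /= [X in _ + X]big1 ?addr0 => [|j _]; last first.
    by rewrite ltnNge leq_addr.
  by apply: eq_bigr => j _; rewrite ltn_ord.
rewrite (shifted_sum H) /estermann_limit.
have -> : \sum_(i < M - n) H i = cg * (q * u ^+ 2) ^+ n *
    \sum_(i < M - n) (s i * u ^+ i * \sum_(j < M - n - i - n) x ^+ j).
  rewrite mulr_sumr; apply: eq_bigr => i _.
  by rewrite /H (shifted_sum (G i)) /G -mulr_sumr [RHS]mulrA.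
have km : (k <= m)%N by lia.
have -> : \sum_(i < M - n) (s i * u ^+ i * \sum_(j < M - n - i - n) x ^+ j)
   = (\sum_(a < k) s a * u ^+ a + d * (1 - x ^+ m) / (1 - x)
       - \sum_(i < m) s i * u ^+ i * x ^+ (m - i)) / (1 - x).
  have -> : (M - n = m + n)%N by rewrite /m; lia.
  rewrite big_split_ord /= [X in _ + X]big1 ?addr0 => [|i _]; last first.
    have -> : (m + n - (m + i) - n = 0)%N by lia.
    by rewrite big_ord0 mulr0.
  have -> : \sum_(a < k) s a * u ^+ a + d * (1 - x ^+ m) / (1 - x) = \sum_(i < m) s i * u ^+ i.
    have [d0|d0] := eqVneq d 0.
      rewrite d0 !mul0r addr0 -(subnKC km) big_split_ord /= [X in _ + X]big1 ?addr0 // => i _.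
      by rewrite s_high ?leq_addr // d0 !mul0r.
    rewrite (dk d0) big_ord0 add0r -mulrA -geometric_sum // mulr_sumr.
    by apply: eq_bigr => i _; rewrite s_high ?(dk d0) // exprMn mulrA.
  rewrite -sumrB mulr_suml; apply: eq_bigr => i _.
  have im := ltn_ord i; have -> : (m + n - i - n = m - i)%N by lia.
  rewrite geometric_sum //; ring.
set P := \sum_(i < N0) _; set L := \sum_(a < k) _; set kap := cg * _.
set err := \sum_(i < m) _.
have -> : P + kap * ((L + d * (1 - x ^+ m) / (1 - x) - err) / (1 - x))
   - (P + kap * (L + d / (1 - x)) / (1 - x))
  = kap / (1 - x) * (- (d / (1 - x)) * x ^+ m - err) by field.
rewrite normrM -mulrA ler_wpM2l //.
have herr : `|err| <= m%:R * `|x| ^+ m.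
  rewrite (le_trans (ler_norm_sum _ _ _)) // mulr_natl.
  have -> : `|x| ^+ m *+ m = \sum_(i < m) `|x| ^+ m by rewrite sumr_const card_ord.
  apply: ler_sum => i _; have im := ltn_ord i.
  have -> : `|x| ^+ m = `|x| ^+ i * `|x| ^+ (m - i) by rewrite -exprD subnKC // ltnW.
  rewrite (normrM (s i * u ^+ i)) (normrX _ x) ler_wpM2r ?exprn_ge0 //.
  by rewrite (normrM (s i)) (normrM q) normrX exprMn ler_wpM2r ?exprn_ge0.
rewrite (le_trans (ler_normB _ _)) // mulrDl mul1r lerD //.
  rewrite normrM normrN normrX ler_wpM2l // -[leLHS]mul1r ler_wpM2r ?exprn_ge0 //.
  by rewrite ler1n.
by rewrite (le_trans herr) // ler_wpM2r ?exprn_ge0 // ler_nat.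
Qed.

End TriangularSums.

(** * The character e_q and Dirichlet characters *)

(** Linear independence of the automorphisms, with all coefficients 1. *)
Lemma galTrace_neq0 (F0 : fieldType) (L : splittingFieldType F0) (K E : {subfield L}) :
  exists y, galTrace K E y != 0.
Proof.
have [y _] := @gal_independent_contra _ L E [in 'Gal(E / K)%g] (fun=> 1) _
  (fingroup.group1 _) (oner_neq0 L).
by under eq_bigr do rewrite mul1r; exists y.
Qed.

Lemma cos_double_neq1 (R : realType) (x : R) : 0 < sin x -> cos (x *+ 2) != 1.
Proof.
move=> s0; have : 0 < sin x ^+ 2 by rewrite exprn_gt0.
have := cos2Dsin2 x; rewrite cos_mulr2n.
by move=> E E1; apply/eqP; move: E E1; rewrite mulr2n; lra.
Qed.

Section AdditiveCharacter.
Context {R : realType} {F : finFieldType} {p : nat}.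
Variable pcharFp : p \in [pchar F].
Local Notation C := R[i]^o.
Local Notation L := (pPrimeCharType pcharFp).
Local Notation trace_nat := (trace_nat pcharFp).
Local Notation e_q := (@e_q R F p pcharFp).

Let cis (x : R) : C := (cos x +i* sin x)%C.
Let zeta (j : nat) : C := cis (2 * pi * j%:R / p%:R).

Let pp : prime p. Proof. exact: pcharf_prime pcharFp. Qed.
Let p0 : p%:R != 0 :> R. Proof. by rewrite pnatr_eq0 -lt0n prime_gt0. Qed.

Let cisD x y : cis (x + y) = cis x * cis y.
Proof.
rewrite /cis cosD sinD [RHS]/GRing.mul /=; congr (_ +i* _)%C.
by rewrite addrC [cos x * _ + _]addrC.
Qed.

Let zetaD i j : zeta (i + j) = zeta i * zeta j.
Proof. by rewrite /zeta natrD mulrDr mulrDl cisD. Qed.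

Let zetap : zeta p = 1.
Proof.
rewrite /zeta mulfK // mulr_natl /cis cos2pi sin2pi; by [].
Qed.

Let zeta_mod j : zeta (j %% p) = zeta j.
Proof.
rewrite {2}(divn_eq j p) zetaD.
have -> : zeta (j %/ p * p) = 1; last by rewrite mul1r.
elim: (j %/ p)%N => [|m IH].
  rewrite mul0n /zeta mulr0 mul0r /cis cos0 sin0; by [].
by rewrite mulSn zetaD zetap IH mul1r.
Qed.

Let e_qE y : e_q y = zeta (trace_nat y). Proof. by []. Qed.

Let trace_lt y : (trace_nat y < p)%N.
Proof.
rewrite /Defs.trace_nat; case: pickP => [j _|_]; first exact: ltn_ord.
exact: prime_gt0.
Qed.

Let natr_inj (a b : nat) : (a < p)%N -> (b < p)%N -> a%:R = b%:R :> L -> a = b.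
Proof.
wlog ab : a b / (a <= b)%N.
  by move=> h ap bp E; case: (leqP a b) => [|/ltnW] ab; [|apply/esym]; exact: h.
move=> ap bp E; have : (p %| b - a)%N.
  by rewrite (dvdn_pcharf pcharFp); rewrite natrB // -[a%:R]/(a%:R : L) E subrr.
move: (b - a)%N (subnKC ab) => d Db pd.
by case: d pd Db => [|d] pd Db; [rewrite -Db addn0|have := dvdn_leq (ltn0Sn d) pd; lia].
Qed.

(** [trace_nat] is additive only modulo p, which suffices because [zeta] has period p. *)
Lemma e_qD x y : e_q (x + y) = e_q x * e_q y.
Proof.
rewrite !e_qE -zetaD -zeta_mod -[RHS]zeta_mod (modn_small (trace_lt _)); congr zeta.
apply: natr_inj; rewrite ?trace_lt ?ltn_pmod ?prime_gt0 //.
rewrite trace_natP.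
have -> : ((trace_nat x + trace_nat y) %% p)%:R = (trace_nat x + trace_nat y)%:R :> L.
  exact: (GRing.natr_mod_pchar (R := L) pcharFp).
by rewrite natrD !trace_natP -raddfD.
Qed.

Lemma e_q0 : e_q 0 = 1.
Proof.
rewrite e_qE.
have -> : trace_nat 0 = 0%N.
  apply: natr_inj; rewrite ?trace_lt ?prime_gt0 //.
  by rewrite trace_natP raddf0.
rewrite /zeta mulr0 mul0r /cis cos0 sin0; by [].
Qed.

Lemma e_q_nontrivial : exists x, e_q x != 1.
Proof.
have [y ty] := @galTrace_neq0 _ L 1%AS {:L}%AS; exists y.
rewrite e_qE; have t0 : (0 < trace_nat y)%N.
  by rewrite lt0n; apply: contra_neq ty => t0; rewrite -trace_natP t0.
have tp := trace_lt y.
set j := trace_nat y in t0 tp *; rewrite /zeta.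
(* This is half the angle of [zeta j]; its sine is positive, so the doubled angle has cosine
   different from 1. *)
have xr : 0 < (pi : R) * j%:R / p%:R < pi.
  apply/andP; split.
    by rewrite divr_gt0 ?mulr_gt0 ?pi_gt0 ?ltr0n // prime_gt0.
  by rewrite ltr_pdivrMr ?ltr0n ?prime_gt0 // ltr_pM2l ?pi_gt0 // ltr_nat.
have s0 := sin_gt0_pi xr.
have -> : 2 * pi * j%:R / p%:R = (pi * j%:R / p%:R) *+ 2 :> R by rewrite mulr2n; ring.
move: (pi * j%:R / p%:R) s0 => x s0.
by apply: contra_neq (cos_double_neq1 s0) => -[].
Qed.

Lemma e_q_nontrivial_character : nontrivial_character e_q.
Proof. by split; [exact: e_qD|exact: e_q0|exact: e_q_nontrivial]. Qed.

Lemma e_q_norm x : `|e_q x| = 1.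
Proof.
have eX m : e_q x ^+ m = e_q (x *+ m).
  by elim: m => [|m IH]; [rewrite mulr0n e_q0|rewrite exprS IH mulrS e_qD].
have : `|e_q x| ^+ p = 1 by rewrite -normrX eX (mulrn_pchar pcharFp) e_q0 normr1.
move/eqP; rewrite pexpr_eq1 ?normr_ge0 ?prime_gt0 //; by move/eqP.
Qed.

End AdditiveCharacter.

(** Pairs of a divisor of degree i and a cofactor of degree n - i; this turns the sum of [r_chi]
    over degree n into the [twisted_sum] terms with i + j = n. *)
Lemma monic_divisor_sum (F : finFieldType) (V : nmodType)
    (H : {poly F} -> {poly F} -> V) n :
  \sum_(a : {poly_n F}) \sum_(d : {poly_n.+1 F} | (polyn d \is monic) && (polyn d %| 'X^n + polyn a))
     H d ('X^n + polyn a)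
  = \sum_(i < n.+1) \sum_(d : {poly_i F}) \sum_(b : {poly_(n - i) F})
      H ('X^i + polyn d) (('X^i + polyn d) * ('X^(n - i) + polyn b)).
Proof.
pose f (t u : {poly F}) : V := if (t \is monic) && (t %| u) then H t u else 0.
transitivity (\sum_(a : {poly_n F}) \sum_(i < n.+1) \sum_(d : {poly_i F})
   f ('X^i + polyn d) ('X^n + polyn a)).
  apply: eq_bigr => a _; rewrite big_mkcond (npoly_sum_degree _ (fun t => f t ('X^n + polyn a))).
  rewrite {1}/f dvd0p; case: eqP => [E|_].
    by have := size_XnD a; rewrite E size_poly0.
  rewrite andbF add0r; apply: eq_bigr => i _.
  rewrite (bigD1 1) ?oner_neq0 //= [X in _ + X]big1 ?addr0 => [|x /andP[_ x1]].
    by apply: eq_bigr => d _; rewrite scale1r.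
  apply: big1 => d _; rewrite /f.
  have -> // : (x *: ('X^i + polyn d) \is monic) = false.
  by rewrite monicE lead_coefZ (monicP (monicXnD d)) mulr1 (negPf x1).
rewrite exchange_big; apply: eq_bigr => i _ /=.
rewrite exchange_big; apply: eq_bigr => d _ /=.
have i_n : (i <= n)%N by rewrite -ltnS.
rewrite -(monic_multiple_sum (fun u => H ('X^i + polyn d) u) (monicXnD d) (size_XnD d) i_n).
rewrite [RHS]big_mkcond; apply: eq_bigr => a _ /=.
by rewrite /f monicXnD.
Qed.

Section Dirichlet.
Context {R : realType} {F : finFieldType}.
Local Notation C := R[i]^o.
Variables (l : {poly F}) (chi : {poly F} -> C).
Hypothesis l_monic : l \is monic.
Hypothesis chiP : dirichlet_character l chi.

Lemma dirichlet_ncop a : ~~ coprimep a l -> chi a = 0.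
Proof. by rewrite -(dirichlet_supp chiP) negbK => /eqP. Qed.

(** By pigeonhole two powers of a agree modulo l, so chi a is a root of unity. *)
Lemma dirichlet_norm a : coprimep a l -> `|chi a| = 1.
Proof.
move=> al; have ca : chi a != 0 by rewrite (dirichlet_supp chiP).
have l0 : l != 0 by rewrite monic_neq0.
have chiX n : chi (a ^+ n) = chi a ^+ n.
  elim: n => [|n IH]; first by rewrite !expr0 (dirichlet1 chiP).
  by rewrite !exprS (dirichletM chiP) IH.
pose T : finType := {poly_((size l).-1) F}.
pose h (i : 'I_#|T|.+1) : T := npolyp _ (a ^+ i %% l).
have /injectivePn[i [j ij]] : ~~ injectiveb h.
  apply/negP => /injectiveP/leq_card; by rewrite card_ord ltnn.
move/(congr1 val) => /=.
have sz t : (size (t %% l)%R <= (size l).-1)%N.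
  by rewrite -ltnS prednK ?ltn_modp // size_poly_gt0.
rewrite /h !npolypK ?sz // => E.
have /(dirichlet_mod chiP) : l %| a ^+ i - a ^+ j.
  by apply/modp_eq0P; rewrite modpD modpN E subrr.
rewrite !chiX => E1.
wlog lt_ij : i j ij E E1 / (i < j)%N.
  move=> hw; case: (ltngtP i j) => [|ji|/val_inj e]; first exact: hw.
    by apply: (hw j i) => //; rewrite eq_sym.
  by rewrite e eqxx in ij.
have : chi a ^+ (j - i) = 1.
  apply: (mulfI (expf_neq0 i ca)); rewrite -exprD subnKC ?mulr1 //; exact: ltnW.
move/(congr1 (fun x => `|x|)); rewrite normrX normr1 => /eqP.
by rewrite pexpr_eq1 ?subn_gt0 // => /eqP.
Qed.

Lemma dirichlet_le1 a : `|chi a| <= 1.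
Proof.
have [al|/dirichlet_ncop ->] := boolP (coprimep a l); first by rewrite dirichlet_norm.
by rewrite normr0 ler01.
Qed.

Lemma dirichlet_conj a : coprimep a l -> chi a * conj_char chi a = 1.
Proof. by move=> al; rewrite /conj_char -normCK dirichlet_norm // expr1n. Qed.

Lemma conj_char_dirichlet : dirichlet_character l (conj_char chi).
Proof.
rewrite /conj_char; split=> [|a b|a b ab|a].
- by rewrite (dirichlet1 chiP) rmorph1.
- by rewrite (dirichletM chiP) rmorphM.
- by rewrite (dirichlet_mod chiP ab).
- by rewrite conjC_eq0 (dirichlet_supp chiP).
Qed.

End Dirichlet.

Section PrimitiveDirichlet.
Context {R : realType} {F : finFieldType}.
Local Notation C := R[i]^o.
Variables (l : {poly F}) (chi : {poly F} -> C).

Lemma conj_char_primitive : primitive_character l chi -> primitive_character l (conj_char chi).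
Proof.
case=> chiP prim; split; first exact: conj_char_dirichlet.
move=> d dm dl h; apply: prim => // f fl df.
by rewrite -[chi f]conjCK -/(conj_char chi f) h // rmorph1.
Qed.

Lemma dirichlet_pair : l \is monic -> primitive_character l chi ->
  primitive_pair l chi (conj_char chi).
Proof.
move=> lm [chiP prim]; have chibP := conj_char_dirichlet chiP.
exact: (Build_primitive_pair (dirichletM chiP) (dirichlet_mod chiP) (dirichlet_ncop chiP)
  (dirichletM chibP) (dirichlet_mod chibP) (dirichlet_ncop chibP) (dirichlet_conj lm chiP) prim).
Qed.

End PrimitiveDirichlet.

(** * The meromorphic continuation of R_2 *)

Section Continuation.
Context {R : realType} {F : finFieldType} {p : nat}.
Variable pcharFp : p \in [pchar F].
Local Notation C := R[i]^o.
Local Notation q := (#|F|%:R : C).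
Local Notation psi := (@e_q R F p pcharFp).
Implicit Types (g l c : {poly F}) (chi : {poly F} -> C) (u : C).

Lemma e_infty_laurent m a : @e_infty R F p pcharFp (laurent a m) = efrac psi m a.
Proof. by rewrite /e_infty /efrac /laurent /= expr1. Qed.

Lemma efrac_norm m a : `|efrac psi m a| = 1.
Proof. exact: e_q_norm. Qed.

Let q_gt0 : 0 < q.
Proof. by rewrite ltr0n; apply/card_gt0P; exists 0. Qed.

Lemma R2_term_sum chi c g u n :
  \sum_(a : {poly_n F}) R2_term pcharFp chi c g u (XnD a)
  = \sum_(i < n.+1) twisted_sum psi g chi c i (n - i) * u ^+ n.
Proof.
transitivity (\sum_(a : {poly_n F})
   \sum_(d : {poly_n.+1 F} | (polyn d \is monic) && (polyn d %| 'X^n + polyn a))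
     (fun d f => chi d * efrac psi g (c * f) * u ^+ n) d ('X^n + polyn a)).
  apply: eq_bigr => a _; rewrite /R2_term /r_chi /= size_XnD /= e_infty_laurent.
  by rewrite !mulr_suml.
rewrite (monic_divisor_sum (fun d f => chi d * efrac psi g (c * f) * u ^+ n)).
apply: eq_bigr => i _; rewrite /twisted_sum mulr_suml; apply: eq_bigr => d _.
by rewrite mulr_suml; apply: eq_bigr => b _; rewrite mulrA.
Qed.

Lemma R2_term_norm_sum chi c g u n : (forall a, `|chi a| <= 1) ->
  \sum_(a : {poly_n F}) `|R2_term pcharFp chi c g u (XnD a)| <= n.+1%:R * `|q * u| ^+ n.
Proof.
move=> chi1.
apply: (@le_trans _ _ (\sum_(a : {poly_n F})
   \sum_(d : {poly_n.+1 F} | (polyn d \is monic) && (polyn d %| 'X^n + polyn a))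
     (fun d f => `|u| ^+ n) (polyn d) ('X^n + polyn a))).
  apply: ler_sum => a _; rewrite /R2_term /r_chi /= size_XnD /= e_infty_laurent.
  rewrite !normrM efrac_norm mulr1 normrX.
  apply: le_trans (ler_wpM2r (exprn_ge0 _ (normr_ge0 _)) (ler_norm_sum _ _ _)) _.
  by rewrite mulr_suml; apply: ler_sum => d _; rewrite ler_piMl ?exprn_ge0.
rewrite (monic_divisor_sum (fun d f => `|u| ^+ n)).
rewrite (eq_bigr (fun=> `|q * u| ^+ n)) => [|i _]; last first.
  rewrite !npoly_sum_const -mulrnA -expnD subnK -1?ltnS //.
  by rewrite -[LHS]mulr_natl natrX normrM exprMn (ger0_norm (ltW q_gt0)).
by rewrite sumr_const card_ord -[leLHS]mulr_natl.
Qed.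

Lemma monic_sum_norm chi i : (forall a, `|chi a| <= 1) -> `|monic_sum chi i| <= `|q| ^+ i.
Proof.
move=> chi1; rewrite (le_trans (ler_norm_sum _ _ _)) // (ger0_norm (ltW q_gt0)).
apply: (@le_trans _ _ (\sum_(a : {poly_i F}) 1)); first exact: ler_sum.
by rewrite npoly_sum_const natrX.
Qed.

Section Twist.
Variables (g l : {poly F}).
Hypothesis g_monic : g \is monic.
Hypothesis l_monic : l \is monic.
Local Notation n := (size g).-1.
Local Notation k := (size l).-1.

Let size_g : size g = n.+1.
Proof. by rewrite prednK // size_poly_gt0 monic_neq0. Qed.
Let size_l : size l = k.+1.
Proof. by rewrite prednK // size_poly_gt0 monic_neq0. Qed.

Lemma R2_rat_limit chi c cb u : primitive_character l chi ->
  coprimep (l * c) g -> g %| cb * (l * c) - 1 -> `|u| < q^-1 ->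
  partial_sum (R2_term pcharFp chi c g u) @ totally --> R2_rat psi g l chi c u.
Proof.
have arith (M0 a b M : nat) : (M0 + (a + b + a + a + b) <= M -> M0 <= M - a - a)%N by lia.
move=> prim lcg hcb u1; have [chiP _] := prim.
have eP := @e_q_nontrivial_character R F p pcharFp.
have pairP := dirichlet_pair l_monic prim.
have := lcg; rewrite coprimepMl => /andP[lg cg].
have gl : coprimep g l by rewrite coprimep_sym.
have chi1 := dirichlet_le1 l_monic chiP.
have x1 : `|q * u| < 1.
  by rewrite normrM (ger0_norm (ltW q_gt0)) mulrC -ltr_pdivlMr // div1r.
have [y [D [y0 y1 D0 hy]]] := linear_geometric_bound (normr_ge0 _) x1.
have y1' : `|y| < 1 by rewrite ger0_norm.
have /cvgCP cvy := expC_cvg0 y1'.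
have ycvg B e : 0 < B -> 0 < e -> exists M0, forall m, (M0 <= m)%N -> B * y ^+ m < e.
  move=> B0 e_gt0; have [|M hM] := cvy (e / B); first by rewrite divr_gt0.
  exists M => m /hM; rewrite sub0r normrN ger0_norm ?exprn_ge0 //.
  by rewrite ltr_pdivlMr // mulrC.
apply: (unordered_cvg (R2_term_norm_sum c g u ^~ chi1)).
  move=> e e_gt0; have Dy : 0 < D / (1 - y) by rewrite divr_gt0 // subr_gt0.
  have [M0 hM0] := ycvg _ _ Dy e_gt0.
  exists M0 => M M' /hM0; apply: le_lt_trans.
  apply: (@le_trans _ _ (\sum_(M <= i < M') D * y ^+ i)); first by apply: ler_sum => i _.
  rewrite -mulr_sumr -mulrA ler_wpM2l ?(ltW D0) // mulrC ler_pdivlMr ?subr_gt0 //.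
  have [MM|/ltnW MM] := leqP M M'; last by rewrite big_geq // mul0r exprn_ge0.
  have -> : (\sum_(M <= i < M') y ^+ i) * (1 - y) = y ^+ M - y ^+ M'.
    rewrite mulr_suml; transitivity (\sum_(M <= i < M') (- y ^+ i.+1 - - y ^+ i)).
      by apply: eq_bigr => i _; rewrite exprS; ring.
    by rewrite telescope_sumr // opprK addrC.
  by rewrite gerBl exprn_ge0.
have -> : (fun M => \sum_(m < M) \sum_(a : {poly_m F}) R2_term pcharFp chi c g u (XnD a))
  = (fun M => \sum_(m < M) \sum_(i < m.+1) twisted_sum psi g chi c i (m - i) * u ^+ m).
  by apply/funext => M; apply: eq_bigr => m _; exact: R2_term_sum.
have low := twisted_sum_vanish eP l_monic size_l pairP g_monic size_g gl hcb.
have high i j : (n <= j)%N -> _ :=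
  twisted_sum_polar eP pairP g_monic size_g i cg.
have shigh := monic_sum_ge eP l_monic size_l pairP.
have dk : (k == 0%N)%:R != 0 :> C -> k = 0%N by case: (k =P 0%N) => // _; rewrite eqxx.
have err := triangle_limit_error (N0 := (n + k)%N) (fun i j => low i j) (fun i j => high i j)
   (fun i => shigh i) dk (fun i => monic_sum_norm i chi1) x1.
have Dl : estermann_limit (twisted_sum psi g chi c) (monic_sum chi) q (chi g) (k == 0%N)%:R u n k (n + k)
   = R2_rat psi g l chi c u.
  rewrite /estermann_limit /R2_rat /finite_part /L_rat /L_finite.
  by have -> : (size l == 1%N) = (k == 0%N) by rewrite {1}size_l eqSS.
rewrite Dl in err.
apply/cvgCP => e e_gt0.
set A := `|_| * _ in err.
have A0 : 0 <= A by rewrite mulr_ge0 // addr_ge0.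
have AD : 0 < (A + 1) * D by rewrite mulr_gt0 // ltr_wpDl.
have [M0 hM0] := ycvg _ _ AD e_gt0.
(* The bracket is the threshold of [triangle_limit_error] with N0 = n + k; it also leaves M - 2 n at
   least [M0]. *)
exists (M0 + (n + k + n + n + k))%N => M hM.
have := err M (leq_trans (leq_addl _ _) hM); rewrite -/A => errM.
rewrite distrC (le_lt_trans errM) // (le_lt_trans _ (hM0 _ (arith _ _ _ _ hM))) //.
rewrite -[leRHS]mulrA ler_pM ?mulr_ge0 ?exprn_ge0 ?hy //.
by rewrite lerDl ler01.
Qed.

Let fin_poly chi c : {poly C} := \sum_(i < n + k) \sum_(j < n)
  (twisted_sum psi g chi c i j)%:P * 'X^(i + j).

Let L_poly chi : {poly C} := \sum_(a < k) (monic_sum chi a)%:P * 'X^a.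

Lemma R2_rat_poly chi c : exists P : {poly C}, forall u, 1 - q * u != 0 ->
  R2_rat psi g l chi c u = P.[u] / (1 - q * u) ^+ 2.
Proof.
exists ((1 - q *: 'X) ^+ 2 * fin_poly chi c + chi g *: ((q *: 'X^2) ^+ n
   * ((1 - q *: 'X) * L_poly chi + (size l == 1%N)%:R%:P))).
move=> u u1; have E1 : (1 - q *: 'X : {poly C}).[u] = 1 - q * u.
  by rewrite hornerD hornerN hornerZ hornerX hornerC.
have E2 : (fin_poly chi c).[u] = finite_part psi g chi c (n + k) n u.
  rewrite /fin_poly horner_sum; apply: eq_bigr => i _; rewrite horner_sum.
  by apply: eq_bigr => j _; rewrite hornerM hornerC hornerXn.
have E3 : (L_poly chi).[u] = L_finite chi k u.
  rewrite /L_poly horner_sum; apply: eq_bigr => a _.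
  by rewrite hornerM hornerC hornerXn.
have E4 : (q *: 'X^2 : {poly C}).[u] = q * u ^+ 2 by rewrite hornerZ hornerXn.
have H (A B A1 B1 : {poly C}) (a d : C) :
    (A ^+ 2 * A1 + a *: (B ^+ n * (A * B1 + d%:P))).[u]
    = A.[u] ^+ 2 * A1.[u] + a * (B.[u] ^+ n * (A.[u] * B1.[u] + d)).
  by rewrite hornerD (hornerM (A ^+ 2)) hornerZ (hornerM (B ^+ n)) !horner_exp hornerD hornerM hornerC.
rewrite /R2_rat /L_rat H E1 E2 E3 E4.
by move: (1 - q * u) u1 => D D0; field.
Qed.

Lemma R2_unique chi c h1 h2 : is_R2 pcharFp chi c g h1 -> is_R2 pcharFp chi c g h2 -> h1 = h2.
Proof.
move=> [m1 s1] [m2 s2]; apply: meromorphic_eq => //.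
apply/nearCP; exists q^-1 => [|u]; first by rewrite invr_gt0.
rewrite sub0r normrN => u1.
have tot_filter := @totally_filter {f : {poly F} | f \is monic}.
exact: (@cvg_unique _ (@norm_hausdorff _ C) _ _ _ _ (s1 _ u1) (s2 _ u1)).
Qed.

(** [R2] is chosen by [xget], so it has its meaning only once a continuation exists; the rational
    function supplies one, and uniqueness identifies the two. *)
Lemma R2_spec chi c cb : primitive_character l chi ->
  coprimep (l * c) g -> g %| cb * (l * c) - 1 ->
  is_R2 pcharFp chi c g (R2 pcharFp chi c g) /\
  forall u, 1 - q * u != 0 -> R2 pcharFp chi c g u = R2_rat psi g l chi c u.
Proof.
move=> prim lcg hcb; have [P hP] := R2_rat_poly chi c.
have [h [hm hE]] := rational_meromorphic 2 P (lt0r_neq0 q_gt0).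
have hR : is_R2 pcharFp chi c g h.
  split=> // u u1; have qu1 : 1 - q * u != 0.
    rewrite subr_eq0; apply: contraTneq u1 => E.
    have : `|q * u| = 1 by rewrite -E normr1.
    rewrite normrM (ger0_norm (ltW q_gt0)) => E1.
    by rewrite -(ltr_pM2l q_gt0) E1 mulfV ?ltxx ?lt0r_neq0.
  by rewrite hE // -hP //; exact: (R2_rat_limit prim lcg hcb).
have R2P : is_R2 pcharFp chi c g (R2 pcharFp chi c g) by apply: xgetPex; exists h.
split=> // u u1; by rewrite (R2_unique R2P hR) hE // hP.
Qed.

End Twist.

Let psiD := @e_qD R F p pcharFp.

Lemma KlE chi x y : Kl pcharFp chi x y = \sum_(z | z != 0) chi z%:P * psi (x * z) * psi (y / z).
Proof. by apply: eq_bigr => z _; rewrite psiD mulrA. Qed.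

Lemma B2_expand chi (x : F) u :
  B2 pcharFp chi x u = Kl pcharFp chi (- 1) x / q
   - (Kl pcharFp chi (- 1) 0 + Kl pcharFp chi 0 x) / (q * (1 - q * u))
   + Kl pcharFp chi 0 0 / (q * (1 - q * u) ^+ 2).
Proof.
rewrite /B2 !big_ord_recl !big_ord0 /= -![bump 0 0]/1%N !addr0 !subr0 !sub0r !subrr.
rewrite !mul1r !mul0r !addn0 !add0n -[(1 + 1)%N]/2%N sqrrN expr1n expr0 !expr1 !mul1r mulr1.
by ring.
Qed.

Lemma qB2_Kl chi (x : F) v : qB2 psi chi x v = Kl pcharFp chi (- 1) x
  + v * (Kl pcharFp chi (- 1) 0 + Kl pcharFp chi 0 x) + v ^+ 2 * Kl pcharFp chi 0 0.
Proof.
rewrite !KlE mulrDr !mulr_sumr -!big_split; apply: eq_bigr => z _ /=.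
by rewrite mulN1r !mul0r e_q0; ring.
Qed.

Lemma B2_qB2 chi (x : F) u v : v = - (1 - q * u)^-1 ->
  B2 pcharFp chi x u = q^-1 * qB2 psi chi x v.
Proof. by move=> ->; rewrite B2_expand qB2_Kl sqrrN exprVn !invfM; ring. Qed.

Lemma Kl_tau chi x : Kl pcharFp chi x 0 = tau pcharFp chi x.
Proof. by apply: eq_bigr => z _; rewrite mul0r addr0. Qed.

Lemma dnear_neq (z a : C) : \forall w \near z^', w != a.
Proof.
have [->|za] := eqVneq a z; first by apply/dnearCP; exists 1.
apply/dnearCP; exists `|z - a|; first by rewrite normr_gt0 subr_eq0 eq_sym.
by move=> w zw _; apply: contraTneq zw => ->; rewrite ltxx.
Qed.

Section Even.
Variables (l : {poly F}) (chi : {poly F} -> C).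
Hypothesis l_monic : l \is monic.
Hypothesis chiP : dirichlet_character l chi.

Let coprime_cst (z : F) : z != 0 -> coprimep z%:P l.
Proof. by move=> z0; rewrite -alg_polyC coprimepZl // coprime1p. Qed.

Lemma Kl_tau_conj x : Kl pcharFp chi 0 x = tau pcharFp (conj_char chi) x.
Proof.
rewrite /Kl /tau (reindex_inj invr_inj) /=; apply: eq_big => z; rewrite ?invr_eq0 // => z0.
rewrite mul0r add0r invrK; congr (_ * _).
have c1 := dirichlet_conj l_monic chiP (coprime_cst z0).
have c0 : chi z%:P != 0 by apply: contra_eq_neq c1 => ->; rewrite mul0r eq_sym oner_eq0.
apply: (mulfI c0); rewrite c1 -(dirichletM chiP) -polyCM divff //.
exact: dirichlet1 chiP.
Qed.

Lemma Kl00 : Kl pcharFp chi 0 0 = (q - 1) * (even_character chi)%:R.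
Proof.
have -> : Kl pcharFp chi 0 0 = \sum_(z : F | z != 0) chi z%:P.
  by apply: eq_bigr => z _; rewrite !mul0r addr0 e_q0 mulr1.
case ev: (even_character chi).
  rewrite mulr1 (eq_bigr (fun=> 1)) => [|z z0]; last first.
    by move/forallP/(_ z): ev; rewrite z0 => /eqP.
  have : \sum_(z : F) (1 : C) = q by rewrite sumr_const.
  by rewrite (bigD1 0) //= => <-; rewrite [RHS]addrC addKr.
rewrite mulr0; move/negbT: ev; rewrite negb_forall => /existsP[z].
rewrite negb_imply => /andP[z0 cz].
have : (chi z%:P - 1) * \sum_(y : F | y != 0) chi y%:P = 0.
  rewrite mulrBl mul1r mulr_sumr [X in _ - X](reindex_inj (mulfI z0)) /=.
  apply/eqP; rewrite subr_eq0; apply/eqP; apply: eq_big => y.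
    by rewrite mulf_eq0 (negPf z0).
  by rewrite polyCM (dirichletM chiP).
by move/eqP; rewrite mulf_eq0 subr_eq0 (negPf cz) => /eqP.
Qed.

End Even.

End Continuation.

(* cbar inverts ell * c modulo g.  With an inverse of c alone the identity
   fails: for #|F| = 3, g = T, ell = T - 1, c = 1 and chi quadratic, both
   R2 (u) and the right-hand side have the shape (1 - u) w + u / (1 - 3 u) for
   a nontrivial cube root of unity w, and the two w agree only if
   cbar = -1 mod T, the inverse of ell * c. *)
Theorem proposition3p12 (R : realType) (F : finFieldType) (p : nat)
    (pcharFp : p \in [pchar F]) (g ell c cbar : {poly F})
    (chi : {poly F} -> R[i]^o) :
  let q : R[i]^o := #|F|%:R in
  g \is monic -> (1 <= (size g).-1)%N -> ell \is monic ->
  coprimep (ell * c) g -> g %| cbar * (ell * c) - 1 ->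
  primitive_character ell chi ->
  [/\ is_R2 pcharFp chi c g (R2 pcharFp chi c g),
      mero_eq (R2 pcharFp chi c g)
        (fun u => chi g * gauss pcharFp ell chi
           * (q * u ^+ 2) ^+ ((size g).-1 - 1) * u ^+ (size ell).-1
           * \sum_(x : F | x != 0)
               B2 pcharFp (conj_char chi) x u
               * R2 pcharFp (conj_char chi) (x *: cbar) g (1 / (q * u)))
    & forall (x : F) (u : R[i]^o), x != 0 -> 1 - q * u != 0 ->
        B2 pcharFp chi x u
        = Kl pcharFp chi (- 1) x / q
          - (tau pcharFp chi (- 1) + tau pcharFp (conj_char chi) x)
              / (q * (1 - q * u))
          + (q - 1) / (q * (1 - q * u) ^+ 2) * (even_character chi)%:R ].
Proof.
move=> q gm gn lm lcg hcb prim; have [chiP _] := prim.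
have q0 : q != 0 by rewrite pnatr_eq0 -lt0n; apply/card_gt0P; exists 0.
have [RP RE] := R2_spec pcharFp gm lm prim lcg hcb.
split=> //; last first.
  move=> x u x0 u1; rewrite B2_expand Kl_tau (Kl_tau_conj pcharFp lm chiP) (Kl00 pcharFp chiP).
  by congr (_ + _); rewrite mulrAC.
have g0 : g != 0 by rewrite monic_neq0.
have l0 : ell != 0 by rewrite monic_neq0.
have size_g : size g = (size g).-1.+1 by rewrite prednK // size_poly_gt0.
have size_l : size ell = (size ell).-1.+1 by rewrite prednK // size_poly_gt0.
have := lcg; rewrite coprimepMl => /andP[lg cg].
have gl : coprimep g ell by rewrite coprimep_sym.
have cbg : coprimep cbar g.
  apply/Bezout_coprimepP; case/dvdpP: hcb => z Dz; exists (ell * c, - z) => /=.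
  by rewrite mulNr -Dz mulrC opprB addrC subrK eqpxx.
have dual x : x != 0 -> forall u, 1 - q * u != 0 ->
   R2 pcharFp (conj_char chi) (x *: cbar) g u = R2_rat (@e_q R F p pcharFp) g ell (conj_char chi) (x *: cbar) u.
  move=> x0; have h1 : coprimep (ell * (x *: cbar)) g.
    by rewrite coprimepMl lg coprimepZl.
  (* For the dual twist x cbar the inverse is c / x, so [R2_spec] applies to the conjugate character
     as well. *)
  have h2 : g %| (x^-1 *: c) * (ell * (x *: cbar)) - 1.
    have -> : (x^-1 *: c) * (ell * (x *: cbar)) = cbar * (ell * c).
      rewrite -scalerAl -!scalerAr scalerA mulVf // scale1r; ring.
    exact: hcb.
  by have [] := R2_spec pcharFp gm lm (conj_char_primitive prim) h1 h2.
(* These points are avoided so that w = 1 / (q u) is a true inverse, 1 - q u and 1 - w are nonzero,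
   and 1 - q w = 1 - 1 / u is nonzero. *)
move=> z; have H : \forall u \near z^', [/\ u != 0, u != q^-1 & u != 1].
  by apply: filterS3 (dnear_neq z 0) (dnear_neq z q^-1) (dnear_neq z 1) => u *; split.
have [e e0 He] := (dnearCP _ _).1 H.
apply/dnearCP; exists e => // u zu uz; have [u0 uq u1] := He u zu uz.
have qu0 : q * u != 0 by rewrite mulf_neq0.
have qu1 : 1 - q * u != 0.
  rewrite subr_eq0; apply: contra_neq uq => E; apply: (mulfI q0).
  by rewrite -E divff.
rewrite RE // -[in LHS]/q.
set w := 1 / (q * u).
have quw : q * u * w = 1 by rewrite /w div1r divff.
have w1 : 1 - w != 0.
  rewrite /w div1r -(inj_eq (mulfI qu0)) mulr0 mulrBr mulr1 divff // subr_eq0 -subr_eq0.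
  by rewrite -opprB oppr_eq0.
have qw1 : 1 - q * w != 0.
  have -> : q * w = u^-1 by rewrite /w; field; rewrite u0 q0.
  rewrite -(inj_eq (mulfI u0)) mulr0 mulrBr mulr1 divff // subr_eq0 //.
rewrite (functional_equation (@e_q_nontrivial_character R F p pcharFp) lm size_l
  (dirichlet_pair lm prim) gm size_g gl hcb w1 quw gn qw1).
have -> : gauss_sum (@e_q R F p pcharFp) ell (size ell).-1 chi = gauss pcharFp ell chi.
  by apply: eq_bigr => a _; rewrite e_infty_laurent.
congr (_ * _); rewrite mulr_sumr; apply: eq_bigr => x x0.
rewrite dual // (@B2_qB2 _ _ _ pcharFp _ x u (w / (1 - w))) ?mulrA //.
have qu1N : q * u - 1 != 0 by rewrite -opprB oppr_eq0.
by rewrite /w div1r; field; rewrite qu1 u0 q0 qu1N.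
Qed.
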